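(* Let $n\ge 2$ be an integer and let $\Psi_\rho^A$, with scale parameter $\rho\in\mathbb R_+$, be the Abel-Poisson wavelet on the unit sphere $\mathcal S^n\subset\mathbb R^{n+1}$. Then its variances in the space and momentum domains are given by the following. (i) $$ \begin{aligned} \mathrm{var}_S(\Psi_\rho^A)=&\Big\{\rho^n+2\left[2(n-1)(1-e^{-2\rho})^n\,\alpha(\rho)\,\rho^2-(4n^2-6n+3)\,\rho^n\right]e^{2\rho}\\ &\;-\left[4(n-1)(1-e^{-2\rho})^n\,\alpha(\rho)\,\rho^2+(4n-5)\,\rho^n\right]e^{4\rho}\Big\}^{-2}\\ &\cdot\left\{16\,(n-1)^2\left[n-1+(n+1)\,e^{2\rho}\right]^2\rho^{2n}\,e^{2\rho}\right\}-1, \end{aligned} $$ where $\alpha$ is a bounded function (of $\rho$). (ii) $$ \mathrm{var}_M(\Psi_\rho^A)=\frac{n\,(n+1)\left[n+(n+3)\,e^{2\rho}+e^{4\rho}\right]e^{2\rho}}{\left[n-1+(n+1)\,e^{2\rho}\right](e^{2\rho}-1)^2}. $$ (iii) The uncertainty product $U(\Psi_\rho^A)=\sqrt{\mathrm{var}_S(\Psi_\rho^A)}\cdot\sqrt{\mathrm{var}_M(\Psi_\rho^A)}$ equals in the limit $\rho\to0$ $$ \lim_{\rho\to0}U(\Psi_\rho^A)=\frac{1}{2}\sqrt{\frac{(n+1)(n+2)(n^2-3n+3)}{n(n-1)}}. $$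
   Context: $\mathcal S^n$ is the $n$-dimensional unit sphere in $\mathbb R^{n+1}$, $\sigma$ is its rotation-invariant surface measure, $\Delta^\ast$ is the Laplace-Beltrami operator on $\mathcal S^n$, and $\lambda=\frac{n-1}{2}$. For $x\in\mathcal S^n$, $\vartheta\in[0,\pi]$ denotes the first spherical coordinate, so that $\cos\vartheta=x_1$ is the first Cartesian coordinate of $x$. $\mathcal C_l^\lambda$ is the Gegenbauer polynomial of order $\lambda$ and degree $l\in\mathbb N_0$ (standard normalization, with generating function $\sum_{l\ge0}\mathcal C_l^\lambda(t)r^l=(1-2tr+r^2)^{-\lambda}$). The Abel-Poisson wavelet with scale parameter $\rho\in\mathbb R_+$ (i.e. $\rho>0$) is the zonal function $$ \Psi_\rho^A(x)=\sum_{l=0}^\infty\frac{\lambda+l}{\lambda}\sqrt{2l\rho}\;e^{-l\rho}\,\mathcal C_l^\lambda(\cos\vartheta),\qquad x\in\mathcal S^n . $$ For $f\in\mathcal C^2(\mathcal S^n)$ with $\int_{\mathcal S^n}x\,|f(x)|^2\,d\sigma(x)\neq0$ (a vector in $\mathbb R^{n+1}$), the variances in the space and momentum domains are $$ \mathrm{var}_S(f)=\left(\frac{\int_{\mathcal S^n}|f(x)|^2\,d\sigma(x)}{\int_{\mathcal S^n}x\,|f(x)|^2\,d\sigma(x)}\right)^2-1,\qquad \mathrm{var}_M(f)=-\frac{\int_{\mathcal S^n}\Delta^\ast f(x)\cdot\overline{f(x)}\,d\sigma(x)}{\int_{\mathcal S^n}|f(x)|^2\,d\sigma(x)}, $$ where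 the square of the vector-valued integral in the denominator of $\mathrm{var}_S$ means its squared Euclidean norm. The uncertainty product of $f$ is $U(f)=\sqrt{\mathrm{var}_S(f)}\cdot\sqrt{\mathrm{var}_M(f)}$.
   Formalization: ''α is a bounded function'' fails on R_+: α grows like ρ^{n-2} as ρ→∞ if n≥3, and like (1/8)ln ρ as ρ→0 if n=2. Instead, for every M, on (0,M]: α is bounded if n>2, and |α(ρ)| ≤ C(1+|ln ρ|) if n=2. *)

(* Defs.v *)
From HB Require Import structures.
From mathcomp Require Import all_boot all_order all_algebra.
From mathcomp Require Import all_classical all_reals all_analysis.

Set Implicit Arguments.
Unset Strict Implicit.
Unset Printing Implicit Defensive.

Import Order.TTheory GRing.Theory Num.Theory.
Import numFieldNormedType.Exports.

Local Open Scope classical_set_scope.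
Local Open Scope ring_scope.

(* The norm MathComp-Analysis puts on 'rV[R]_m is the sup norm, whence this
   separate Euclidean norm. *)
Definition enorm (R : realType) (m : nat) (x : 'rV[R]_m) : R :=
  Num.sqrt (\sum_(i < m) x 0 i ^+ 2).

(* The unit sphere S^n of R^(n+1). *)
Definition sphere (R : realType) (n : nat) : set 'rV[R]_n.+1 :=
  [set x | enorm x = 1].
Arguments sphere : clear implicits.

(* (cos t, sin t * xi) : the point of S^(m+1) with first spherical coordinate t
   lying over xi in S^m. *)
Definition sph_point (R : realType) (m : nat) (t : R) (xi : 'rV[R]_m.+1) :
    'rV[R]_m.+2 :=
  row_mx (\row_(_ < 1) cos t) (sin t *: xi).

(* Integral over S^n against the (unnormalized) surface measure sigma_n, in
   spherical coordinates:
     d sigma_(m+1) (cos t, sin t * xi) = (sin t)^m dt d sigma_m(xi), t in [0, pi],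
   starting from the counting measure on S^0 = {1, -1}. *)
Fixpoint sphere_integral (R : realType) (n : nat) :
    ('rV[R]_n.+1 -> R) -> R :=
  match n with
  | 0%N => fun f => f (const_mx 1) + f (const_mx (-1))
  | m.+1 => fun f =>
      \int[@lebesgue_measure R]_(t in `[0, pi])
        (sin t ^+ m * sphere_integral (fun xi : 'rV[R]_m.+1 => f (sph_point t xi)))
  end.

(* A function on S^n is represented by a function on R^(n+1) of which only the
   values on S^n matter; it is extended to R^(n+1) \ {0} by f (x / |x|). *)
Definition hom_ext (R : realType) (n : nat) (f : 'rV[R]_n.+1 -> R)
    (x : 'rV[R]_n.+1) : R :=
  f ((enorm x)^-1 *: x).

Definition partial (R : realType) (n : nat) (i : 'I_n.+1)
    (f : 'rV[R]_n.+1 -> R) (x : 'rV[R]_n.+1) : R :=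
  derive f x (delta_mx 0 i).

(* f is twice continuously differentiable on S^n. *)
Definition sphere_C2 (R : realType) (n : nat) (f : 'rV[R]_n.+1 -> R) : Prop :=
  forall (x : 'rV[R]_n.+1), x != 0 -> forall i j : 'I_n.+1,
    [/\ derivable (hom_ext f) x (delta_mx 0 i),
        derivable (partial i (hom_ext f)) x (delta_mx 0 j) &
        {for x, continuous (partial j (partial i (hom_ext f)))}].

(* Laplace-Beltrami operator of S^n: the Euclidean Laplacian of the extension
   of f that is constant along rays. *)
Definition laplace_beltrami (R : realType) (n : nat) (f : 'rV[R]_n.+1 -> R)
    (x : 'rV[R]_n.+1) : R :=
  \sum_(i < n.+1) partial i (partial i (hom_ext f)) x.

(* All functions below are real-valued, so complex conjugation is omitted. *)
Definition sq_mass (R : realType) (n : nat) (f : 'rV[R]_n.+1 -> R) : R :=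
  sphere_integral (fun x => `|f x| ^+ 2).

Definition moment_vec (R : realType) (n : nat) (f : 'rV[R]_n.+1 -> R) :
    'rV[R]_n.+1 :=
  \row_(i < n.+1) sphere_integral (fun x : 'rV[R]_n.+1 => x 0 i * `|f x| ^+ 2).

Definition varS (R : realType) (n : nat) (f : 'rV[R]_n.+1 -> R) : R :=
  sq_mass f ^+ 2 / enorm (moment_vec f) ^+ 2 - 1.

Definition varM (R : realType) (n : nat) (f : 'rV[R]_n.+1 -> R) : R :=
  - (sphere_integral (fun x => laplace_beltrami f x * f x) / sq_mass f).

Definition uncertainty (R : realType) (n : nat) (f : 'rV[R]_n.+1 -> R) : R :=
  Num.sqrt (varS f) * Num.sqrt (varM f).

(* Coefficient of r^l in the Taylor expansion at r = 0 of the generating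
   function (1 - 2 t r + r^2)^(-lam). *)
Definition gegenbauer (R : realType) (lam : R) (l : nat) (t : R) : R :=
  derive1n l (fun r : R => (1 - 2 * t * r + r ^+ 2) `^ (- lam)) 0 / (l`!)%:R.

Definition glam (R : realType) (n : nat) : R := (n%:R - 1) / 2.
Arguments glam : clear implicits.

Definition AP_term (R : realType) (n : nat) (rho : R) (x : 'rV[R]_n.+1)
    (l : nat) : R :=
  (glam R n + l%:R) / glam R n * Num.sqrt (2 * l%:R * rho)
  * expR (- (l%:R * rho)) * gegenbauer (glam R n) l (x 0 0).

Definition abel_poisson (R : realType) (n : nat) (rho : R)
    (x : 'rV[R]_n.+1) : R :=
  limn (series (AP_term rho x)).

(* Main.v *)
Require Import Defs.
From HB Require Import structures.
From mathcomp Require Import all_boot all_order all_algebra.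
From mathcomp Require Import all_classical all_reals all_analysis.
From mathcomp Require Import ring lra zify.
From mathcomp Require Import polyrcf.

Set Implicit Arguments.
Unset Strict Implicit.
Unset Printing Implicit Defensive.

Import Order.TTheory GRing.Theory Num.Theory.
Import numFieldNormedType.Exports.

Local Open Scope classical_set_scope.
Local Open Scope ring_scope.

(** The wavelet is a zonal function, [g (x_0)] with
    [g = sum_l a_l C_l] and [a_l = (lam + l) / lam * sqrt (2 l rho) * e^(-l rho)],
    where [C_l] is the Gegenbauer polynomial of order [lam = (n - 1) / 2].  As
    [C_l] and its derivatives are bounded on [[-1, 1]] by a power of [l], the
    factor [e^(-l rho)] makes the series and its formal derivatives converge
    uniformly there; this gives convergence, [C^2] regularity on the sphere
    ([zonal_sphere_C2]) and termwise integration ([gegp_parseval],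
    [gegp_parseval_moment]).

    All integrals over the sphere reduce to integrals of [sin^(n-1)] times a
    function of [cos] over [[0, pi]], for which the [C_l] are orthogonal: they are
    eigenfunctions of the Laplace-Beltrami operator, with eigenvalues
    [- l (l + n - 1)] ([gegp_ode], [gegp_orthogonal]).  The three-term recurrence
    then gives their norms and the integrals of [x_0 C_l C_(l+1)].  With
    [q = e^(-2 rho)] and a common factor removed:
    - the mass is [sum_l l N_l q^l], where [N_l] is the dimension of the space of
      spherical harmonics of degree [l];
    - the integral of [- (Laplacian f) f] is [sum_l l (l + n - 1) l N_l q^l];
    - the moment vector points along the first axis, with length
      [2 e^(-rho) T], [T = sum_l sqrt (l (l + 1)) binomial(l + n - 1, n - 1) q^l].
    The coefficients of the first two series are polynomials in [l] times
    binomial coefficients, so both sums are rational in [q]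
    ([abel_poisson_massE], [abel_poisson_laplaceE]); their quotient is (ii).

    The third series has no closed form because of the square root.  Replacing
    [sqrt (l (l + 1))] by [l + 1/2 - 1 / (8 (l + n - 1))] leaves a rational
    function of [q], and the error, of order [1 / l^2], is what [alpha] records
    ([ap_alpha], [alpha_series]).  The error series is bounded by a multiple of
    [(1 - q)^(-(n-2))] when [n > 2], and by [- ln (1 - q) / q] when [n = 2]; this
    gives the bounds on [alpha], and (i) is algebra ([alpha_moment_sum]).

    For (iii), [var_S / rho^2] and [rho^2 var_M] are continuous expressions in
    [(1 - e^(-rho)) / rho], [(1 - q) / rho] and [rho alpha], which tend to [1], [2]
    and [0] ([varS_scaled], [varM_scaled]). *)

(** * Derivatives of real-valued functions, in pointwise form *)

Section DeriveRules.
Variables (R : realType) (V : normedModType R) (x v : V).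
Implicit Types (f g : V -> R) (a b c : R).

Lemma is_derive_ptD f g a b : is_derive x v f a -> is_derive x v g b ->
  is_derive x v (fun y => f y + g y) (a + b).
Proof. by move=> df dg; exact: (@is_deriveD _ _ _ f g). Qed.

Lemma is_derive_ptN f a : is_derive x v f a -> is_derive x v (fun y => - f y) (- a).
Proof. by move=> df; exact: (@is_deriveN _ _ _ f). Qed.

Lemma is_derive_ptB f g a b : is_derive x v f a -> is_derive x v g b ->
  is_derive x v (fun y => f y - g y) (a - b).
Proof. by move=> df dg; apply: is_derive_ptD => //; exact: is_derive_ptN. Qed.

Lemma is_derive_ptM f g a b : is_derive x v f a -> is_derive x v g b ->
  is_derive x v (fun y => f y * g y) (f x * b + g x * a).
Proof. by move=> df dg; exact: (@is_deriveM _ _ f g). Qed.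

Lemma is_derive_ptZ f c a : is_derive x v f a -> is_derive x v (fun y => c * f y) (c * a).
Proof.
move=> df; have dc : is_derive x v (fun=> c) 0 by exact: is_derive_cst.
by apply: is_derive_eq (is_derive_ptM dc df) _; rewrite mulr0 addr0.
Qed.

Lemma is_derive_ptV f a : f x != 0 -> is_derive x v f a ->
  is_derive x v (fun y => (f y)^-1) (- (f x ^- 2) * a).
Proof.
move=> fx [df <-]; apply: DeriveDef; first exact: derivableV.
by rewrite deriveV.
Qed.

Lemma is_derive_pt_sum n (h : 'I_n -> V -> R) (dh : 'I_n -> R) :
  (forall i, is_derive x v (h i) (dh i)) ->
  is_derive x v (fun y => \sum_(i < n) h i y) (\sum_(i < n) dh i).
Proof.
move=> hd; have := is_derive_sum hd.
by congr is_derive; apply/funext => y; rewrite fct_sumE.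
Qed.

End DeriveRules.

(** * Gegenbauer polynomials: recurrence, derivative, differential equation *)

(** The pair [(C_l, C_(l-1))], with [C_(-1) = 0]: with this convention the
    three-term recurrence holds from [l = 0] on. *)
Fixpoint gegp_pair (R : realFieldType) (lam : R) (l : nat) :
    {poly R} * {poly R} :=
  if l is k.+1 then
    let cb := gegp_pair lam k in
    ((k.+1%:R^-1)%:P * (2 * (k%:R + lam%:P) * 'X * cb.1
                        - (k%:R + 2 * lam%:P - 1) * cb.2), cb.1)
  else (1, 0).

HB.lock Definition gegp (R : realFieldType) (lam : R) (l : nat) := (gegp_pair lam l).1.
(** [C_(l-1)], and [0] for [l = 0]. *)
HB.lock Definition gegp1 (R : realFieldType) (lam : R) (l : nat) := (gegp_pair lam l).2.

Section Gegp.
Variable R : realFieldType.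
Implicit Types (lam : R) (l : nat).

Lemma gegp0 lam : gegp lam 0 = 1. Proof. by rewrite gegp.unlock. Qed.
Lemma gegp10 lam : gegp1 lam 0 = 0. Proof. by rewrite gegp1.unlock. Qed.
Lemma gegp1S lam l : gegp1 lam l.+1 = gegp lam l.
Proof. by rewrite gegp.unlock gegp1.unlock. Qed.

Lemma natrpoly_neq0 l : (l.+1%:R : {poly R}) != 0.
Proof. by rewrite -polyC_natr polyC_eq0 pnatr_eq0. Qed.

Lemma gegp_rec lam l :
  l.+1%:R * gegp lam l.+1 =
  2 * (l%:R + lam%:P) * 'X * gegp lam l - (l%:R + 2 * lam%:P - 1) * gegp1 lam l.
Proof.
rewrite gegp.unlock gegp1.unlock /= mulrA -polyC_natr -polyCM mulfV ?pnatr_eq0 //.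
by rewrite polyC1 mul1r.
Qed.

(** The polynomials of order [lam] in terms of those of order [lam + 1].  The two
    identities are proved together: the recurrence for order [lam + 1] gives the
    second at [l + 1] from the first at [l], and the recurrence for order [lam]
    then gives the first at [l + 1]. *)
Lemma gegp_raise lam l :
  l.+1%:R * gegp lam l.+1 =
    2 * lam%:P * ('X * gegp (lam + 1) l - gegp1 (lam + 1) l) /\
  (l%:R + 2 * lam%:P) * gegp lam l =
    2 * lam%:P * (gegp (lam + 1) l - 'X * gegp1 (lam + 1) l).
Proof.
elim: l => [|l [A B]].
  by rewrite gegp_rec !gegp0 !gegp10; split; ring.
have := gegp_rec lam l.+1; have := gegp_rec (lam + 1) l.
rewrite !gegp1S polyCD polyC1.
move: A B.
move: (gegp lam l.+2) (gegp lam l.+1) (gegp lam l)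
  (gegp (lam + 1) l.+1) (gegp (lam + 1) l) (gegp1 (lam + 1) l).
move=> c2 c1 c0 d1 d0 dm A B Hd Hc.
have B' : (l.+1%:R + 2 * lam%:P) * c1 = 2 * lam%:P * (d1 - 'X * d0).
  apply: (mulfI (natrpoly_neq0 l)).
  transitivity ((l.+1%:R + 2 * lam%:P) * (l.+1%:R * c1)); first by ring.
  rewrite A.
  transitivity (2 * lam%:P * (l.+1%:R * d1 - l.+1%:R * 'X * d0)); last by ring.
  by rewrite Hd; ring.
split=> //; rewrite Hc.
transitivity ('X * (l.+1%:R * c1 + (l.+1%:R + 2 * lam%:P) * c1)
   - (l%:R + 2 * lam%:P) * c0); first by ring.
by rewrite A B' B; ring.
Qed.

Lemma deriv_natr l : (l%:R : {poly R})^`() = 0.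
Proof. by rewrite -polyC_natr derivC. Qed.

(** Differentiation raises the order by one, so that bounds on all derivatives
    follow from bounds on the polynomials themselves. *)
Lemma deriv_gegp lam l : (gegp lam l)^`() = 2 * lam%:P * gegp1 (lam + 1) l.
Proof.
have [m] := ubnP l; elim: m l => // m IH [|l] lm.
  by rewrite gegp0 gegp10 poly.derivE mulr0.
have IHl : (gegp lam l)^`() = 2 * lam%:P * gegp1 (lam + 1) l by apply: IH.
apply: (mulfI (natrpoly_neq0 l)).
transitivity (l.+1%:R * gegp lam l.+1)^`().
  by rewrite derivM deriv_natr mul0r add0r.
rewrite gegp_rec gegp1S.
rewrite !(derivM, derivB, derivD, derivC, derivX, deriv_natr) IHl.
have [_ B] := gegp_raise lam l.
case: l B lm IHl => [|l] B lm IHl.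
  by rewrite !gegp10 !gegp0 -!polyC1 !derivC; ring.
have [A _] := gegp_raise lam l.
rewrite !gegp1S in B *; rewrite (IH l (ltnW lm)).
have Hd := gegp_rec (lam + 1) l; rewrite polyCD polyC1 in Hd.
transitivity (l.+1%:R * gegp lam l.+1 + (l.+1%:R + 2 * lam%:P) * gegp lam l.+1 +
 2 * lam%:P * (2 * (l.+1%:R + lam%:P) * 'X * gegp (lam + 1) l
   - (l.+1%:R + 2 * lam%:P - 1) * gegp1 (lam + 1) l)).
  by ring.
rewrite A B.
transitivity (2 * lam%:P * (gegp (lam + 1) l.+1 + l.+1%:R * gegp (lam + 1) l.+1));
  last by ring.
by rewrite Hd; ring.
Qed.

(** Obtained by differentiating the first-order relations
    [l C_l = 'X C_l' - C_(l-1)'] and [(l + 2 lam) C_l = C_(l+1)' - 'X C_l'], which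
    are [gegp_raise] rewritten with [deriv_gegp], and eliminating [C_(l-1)]. *)
Lemma gegp_ode lam l :
  (1 - 'X ^+ 2) * (gegp lam l)^`()^`() =
  (2 * lam%:P + 1) * 'X * (gegp lam l)^`()
  - l%:R * (l%:R + 2 * lam%:P) * gegp lam l.
Proof.
case: l => [|l].
  by rewrite gegp0 -!polyC1 !derivC; ring.
have [A _] := gegp_raise lam l; have [_ B] := gegp_raise lam l.
have dC : (gegp lam l)^`() = 2 * lam%:P * gegp1 (lam + 1) l by apply: deriv_gegp.
have dC1 : (gegp lam l.+1)^`() = 2 * lam%:P * gegp (lam + 1) l by rewrite deriv_gegp gegp1S.
have A' : l.+1%:R * gegp lam l.+1 = 'X * (gegp lam l.+1)^`() - (gegp lam l)^`().
  by rewrite A dC dC1; ring.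
have B' : (l%:R + 2 * lam%:P) * gegp lam l = (gegp lam l.+1)^`() - 'X * (gegp lam l)^`().
  by rewrite B dC dC1; ring.
move: A' B'; clear.
move: (gegp lam l.+1) (gegp lam l) => f g A B.
have := congr1 (@deriv R) A; have := congr1 (@deriv R) B.
rewrite !(derivM, derivB, derivN, derivD, derivC, derivX, deriv_natr).
move: A; clear B.
move: f^`() f^`()^`() g^`() g^`()^`() => f1 f2 g1 g2 A Hb Ha.
have g1E : g1 = 'X * f1 - l.+1%:R * f by rewrite A; ring.
have g2E : g2 = 'X * f2 - l%:R * f1.
  transitivity ((1 * f1 + 'X * f2 - g2) * (-1) + f1 + 'X * f2); first by ring.
  by rewrite -Ha; ring.
transitivity ((l.+1%:R + 2 * lam%:P) * g1 - l%:R * 'X * f1 +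
  (f2 - (1 * g1 + 'X * g2) - ((0 + (0 * lam%:P + 2 * 0)) * g + (l%:R + 2 * lam%:P) * g1))).
  by rewrite g2E g1E; ring.
by rewrite -Hb g1E; ring.
Qed.

End Gegp.

(** * Gegenbauer polynomials: values at the end points and maximum *)

Section GegpEval.
Variable R : realFieldType.
Implicit Types (lam t : R) (l : nat).

Lemma horner_natr l t : (l%:R : {poly R}).[t] = l%:R.
Proof. by rewrite -polyC_natr hornerC. Qed.

Lemma gegp_rec_eval lam l t :
  l.+1%:R * (gegp lam l.+1).[t] =
  2 * (l%:R + lam) * t * (gegp lam l).[t]
  - (l%:R + 2 * lam - 1) * (gegp1 lam l).[t].
Proof.
have := congr1 (horner^~ t) (gegp_rec lam l).
move: (gegp lam l.+1) (gegp lam l) (gegp1 lam l) => a b c.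
by rewrite !(hornerE, horner_natr).
Qed.

Lemma gegpN lam l t : (gegp lam l).[- t] = (-1) ^+ l * (gegp lam l).[t].
Proof.
suff : (gegp lam l).[- t] = (-1) ^+ l * (gegp lam l).[t] /\
       (gegp1 lam l).[- t] = - (-1) ^+ l * (gegp1 lam l).[t] by case.
elim: l => [|l [IH IH1]].
  by rewrite gegp0 gegp10 !hornerE; split; ring.
rewrite gegp1S IH exprS; split; last by ring.
have nz : (l.+1%:R : R) != 0 by rewrite pnatr_eq0.
apply: (mulfI nz); rewrite gegp_rec_eval IH IH1.
transitivity (-1 * (-1) ^+ l * (l.+1%:R * (gegp lam l.+1).[t])); last by ring.
by rewrite gegp_rec_eval; ring.
Qed.

Lemma gegp_at1S lam l :
  l.+1%:R * (gegp lam l.+1).[1] = (l%:R + 2 * lam) * (gegp lam l).[1].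
Proof.
rewrite gegp_rec_eval.
suff -> : (l%:R + 2 * lam - 1) * (gegp1 lam l).[1] = l%:R * (gegp lam l).[1].
  by ring.
elim: l => [|l IH]; first by rewrite gegp10 !hornerE; ring.
by rewrite gegp_rec_eval IH gegp1S; ring.
Qed.

Lemma gegp_at1_gt0 lam l : 0 < lam -> 0 < (gegp lam l).[1].
Proof.
move=> lam0; elim: l => [|l IH]; first by rewrite gegp0 hornerE.
have l0 : (0 : R) < l.+1%:R by rewrite ltr0n.
rewrite -(pmulr_rgt0 _ l0) gegp_at1S mulr_gt0 //.
by rewrite ltr_wpDl ?ler0n // mulr_gt0.
Qed.

(** A crude power bound is enough, against the factor [e^(-l rho)]. *)
Lemma gegp_at1_le lam l K : 0 < lam -> 2 * lam <= K%:R ->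
  (gegp lam l).[1] <= (l.+1%:R) ^+ K.
Proof.
move=> lam0 lamK; elim: l => [|l IH]; first by rewrite gegp0 hornerE expr1n.
have l0 : (0 : R) < l.+1%:R by rewrite ltr0n.
rewrite -(ler_pM2l l0) gegp_at1S.
apply: (@le_trans _ _ ((l.+1%:R + K%:R) * l.+1%:R ^+ K)).
  apply: ler_pM => //.
  - by rewrite addr_ge0 ?ler0n // mulr_ge0 // ltW.
  - exact/ltW/gegp_at1_gt0.
  - by rewrite lerD // ler_nat.
elim: K {lamK IH} => [|K IH]; first by rewrite addr0 !expr0.
have e0 : (0 : R) <= l.+1%:R ^+ K by rewrite exprn_ge0 // ltW.
have : l.+2%:R * ((l.+1%:R + K%:R) * l.+1%:R ^+ K) <= l.+2%:R * (l.+1%:R * l.+2%:R ^+ K) :> R.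
  by rewrite ler_wpM2l.
have -> : l.+2%:R * (l.+1%:R * l.+2%:R ^+ K) = l.+1%:R * l.+2%:R ^+ K.+1 :> R.
  by rewrite exprS; ring.
apply: le_trans.
rewrite exprS (mulrA _ l.+1%:R) (mulrA l.+2%:R) ler_wpM2r //.
rewrite -[K.+1]addn1 -[l.+2]addn1 !natrD.
have : (0 : R) <= K%:R by rewrite ler0n.
nra.
Qed.
End GegpEval.

(** Sonin's argument: for [f = C_l] the differential equation shows that
    [f^2 + (1 - x^2) f'^2 / (l (l + 2 lam))] increases on [[0, 1]]; it dominates
    [f^2], and equals [f^2] at [1].  Parity covers [[-1, 0]]. *)
Lemma norm_gegp_le (R : rcfType) (lam t : R) (l : nat) : 0 < lam -> `|t| <= 1 ->
  `|(gegp lam l).[t]| <= (gegp lam l).[1].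
Proof.
move=> lam0.
wlog t0 : t / 0 <= t => [H|].
  have [|/ltW t0 t1] := leP 0 t; first exact: H.
  rewrite -[t]opprK gegpN normrM normrX normrN1 expr1n mul1r.
  by apply: H; rewrite ?normrN // oppr_ge0.
rewrite ger0_norm // => t1.
case: l => [|l]; first by rewrite gegp0 !hornerE normr1.
set f := gegp lam l.+1; set mu : R := l.+1%:R * (l.+1%:R + 2 * lam).
have l0 : (0 : R) < l.+1%:R by rewrite ltr0n.
have mu0 : 0 < mu by rewrite mulr_gt0 // addr_gt0 // mulr_gt0.
pose E := f ^+ 2 + (mu^-1)%:P * ((1 - 'X ^+ 2) * f^`() ^+ 2).
have E'E x : E^`().[x] = 4 * lam * mu^-1 * x * f^`().[x] ^+ 2.
  have -> : E^`() = 2 * f * f^`() + (mu^-1)%:P *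
      (2 * f^`() * ((1 - 'X ^+ 2) * f^`()^`()) - 2 * 'X * f^`() ^+ 2).
    rewrite /E !expr2 !(derivM, derivB, derivN, derivD, derivC, derivX); ring.
  rewrite gegp_ode -/f !(hornerE, horner_natr) /=.
  have muK : mu^-1 * mu = 1 by rewrite mulVf // gt_eqF.
  transitivity (2 * f.[x] * f^`().[x] * (1 - mu^-1 * mu) + 4 * lam * mu^-1 * x * f^`().[x] ^+ 2).
    by rewrite /mu; ring.
  by rewrite muK; ring.
have : E.[t] <= E.[1].
  apply: (@ler_hornerW _ 0 1) => //; rewrite ?in_itv /= ?t0 ?ler01 ?lexx //.
  move=> x; rewrite in_itv /= => /andP[x0 _]; rewrite E'E.
  rewrite mulr_ge0 ?sqr_ge0 // !mulr_ge0 ?(ltW x0) ?(ltW lam0) //.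
  by rewrite invr_ge0 ltW.
have EE x : E.[x] = f.[x] ^+ 2 + mu^-1 * ((1 - x ^+ 2) * f^`().[x] ^+ 2).
  by rewrite /E !hornerE.
rewrite !EE expr1n subrr mul0r mulr0 addr0 => H.
have f1 : 0 < f.[1] by exact: gegp_at1_gt0.
rewrite -ler_sqr ?nnegrE ?normr_ge0 ?(ltW f1) // real_normK ?num_real //.
apply: le_trans H; rewrite lerDl.
rewrite mulr_ge0 ?invr_ge0 ?(ltW mu0) // mulr_ge0 ?sqr_ge0 //.
by rewrite subr_ge0; nra.
Qed.

(** * The generating function *)

Section GeneratingFunction.
Variables (R : realType) (lam t : R).

Let P : {poly R} := 1 - 2 * t%:P * 'X + 'X ^+ 2.
Let G (r : R) := P.[r] `^ (- lam).

Let PE r : P.[r] = 1 - 2 * t * r + r ^+ 2.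
Proof. by rewrite /P !hornerE. Qed.

Let dPE r : P^`().[r] = 2 * (r - t).
Proof.
rewrite /P !(poly.derivE, deriv_natr) !hornerE /=; ring.
Qed.

Let near_P r : 0 < P.[r] -> \forall s \near r, 0 < P.[s].
Proof.
move=> Pr; have := @continuous_horner R P r.
by move/cvgrPdist_lt => /(_ _ Pr); apply: filterS => s; rewrite ltr_distl; lra.
Qed.

(** The generating function satisfies [P G' = - lam P' G] with
    [P = 1 - 2 t r + r^2]; this is its [l]-th derivative.  The derivatives of [G]
    are shown to exist along the way, since the identity expresses each of them
    through the two preceding ones wherever [P > 0]. *)
Lemma genfun_ode l r : 0 < P.[r] ->
  [/\ derivable (derive1n l.-1 G) r 1, derivable (derive1n l G) r 1 &
  P.[r] * derive1n l.+1 G r = - (l%:R + lam) * (2 * (r - t)) * derive1n l G r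
     - l%:R * (l%:R - 1 + 2 * lam) * derive1n l.-1 G r].
Proof.
elim: l r => [|l IH] r Pr.
  have D : is_derive r 1 G (- lam * P.[r] `^ (- lam - 1) * P^`().[r]).
    have dpow := is_derive1_powR (- lam) Pr.
    have dPr := is_derive_poly P r.
    exact: (is_derive1_comp dpow dPr).
  split; [by case: D..|].
  rewrite derive1n1 derive1n0 derive1E; case: D => _ ->.
  have E : P.[r] * P.[r] `^ (- lam - 1) = G r.
    rewrite -{1}[P.[r]]powRr1 ?ltW // -powRD ?(gt_eqF Pr) ?implybT //.
    by rewrite addrC subrK.
  transitivity (- lam * (P.[r] * P.[r] `^ (- lam - 1)) * P^`().[r]); first by ring.
  by rewrite E dPE; ring.
have dP (s : R) : is_derive s (1 : R) (horner P) (2 * (s - t)).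
  by rewrite -dPE; exact: is_derive_poly.
have dD k (s : R) : derivable (derive1n k G) s 1 ->
    is_derive s 1 (derive1n k G) (derive1n k.+1 G s).
  by move=> h; rewrite derive1nS derive1E; apply: DeriveDef.
have dl (s : R) : 0 < P.[s] -> is_derive s 1 (derive1n l G) (derive1n l.+1 G s).
  by move=> /IH[_ + _]; exact: dD.
(* the coefficient of the last term vanishes when l = 0 *)
have dl1 (s : R) : 0 < P.[s] ->
    is_derive s (1 : R) (fun r => l%:R * derive1n l.-1 G r) (l%:R * derive1n l G s).
  move=> Ps; have [d _ _] := IH s Ps.
  case: l d {IH dl} => [|l] d; last exact/is_derive_ptZ/dD.
  rewrite mul0r (_ : (fun r => _) = cst 0); first exact: is_derive_cst.
  by apply/funext => y; rewrite mul0r.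
pose rhs (s : R) := - (l%:R + lam) * ((2 * (s - t)) * derive1n l G s)
     - (l%:R - 1 + 2 * lam) * (l%:R * derive1n l.-1 G s).
have E s : 0 < P.[s] -> derive1n l.+1 G s = rhs s * P.[s]^-1.
  move=> Ps; have [_ _ e] := IH s Ps.
  apply: (mulfI (lt0r_neq0 Ps)); rewrite e [RHS]mulrC divfK ?lt0r_neq0 //.
  by rewrite /rhs; ring.
have drhs : is_derive r (1 : R) rhs
    (- (l%:R + lam) * (2 * (r - t) * derive1n l.+1 G r + derive1n l G r * 2)
     - (l%:R - 1 + 2 * lam) * (l%:R * derive1n l G r)).
  apply: is_derive_ptB; apply: is_derive_ptZ; last exact: dl1.
  apply: is_derive_ptM; last exact: dl.
  have di : is_derive r (1 : R) (fun s : R => 2 * (s - t)) (2 * (1 - 0)).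
    apply: is_derive_ptZ; apply: (@is_derive_ptB _ _ _ _ id (fun=> t)); exact: is_derive_cst.
  by apply: is_derive_eq di _; rewrite subr0 mulr1.
have dS : is_derive r (1 : R) (derive1n l.+1 G)
    (rhs r * (- (P.[r] ^- 2) * (2 * (r - t))) + P.[r]^-1 *
      (- (l%:R + lam) * (2 * (r - t) * derive1n l.+1 G r + derive1n l G r * 2)
     - (l%:R - 1 + 2 * lam) * (l%:R * derive1n l G r))).
  apply: (@near_eq_is_derive _ _ _ (fun s => rhs s * P.[s]^-1)).
    by apply: filterS (near_P Pr) => s Ps; rewrite E.
  by apply: is_derive_ptM => //; apply: is_derive_ptV => //; exact: lt0r_neq0.
split.
- by have [_ d _] := IH r Pr.
- by case: dS.
rewrite derive1nS derive1E; case: dS => _ ->.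
have -> : rhs r = P.[r] * derive1n l.+1 G r.
  by rewrite E // [RHS]mulrC divfK ?lt0r_neq0.
have Pn := lt0r_neq0 Pr.
rewrite [l.+1.-1]/= -!natr1.
move: (derive1n l.+1 G r) (derive1n l G r) P.[r] Pn => g1 g0 p Pn.
by field.
Qed.

Lemma gegenbauer_genfun l : gegenbauer lam l t = derive1n l G 0 / l`!%:R.
Proof.
by rewrite /gegenbauer; congr (@derive1n R R l _ 0 / _); apply/funext => r; rewrite /G PE.
Qed.

(** At [r = 0] the differentiated equation is the three-term recurrence. *)
Lemma gegenbauerE l : gegenbauer lam l t = (gegp lam l).[t].
Proof.
have P0 : P.[0] = 1 by rewrite PE; ring.
have P0' : 0 < P.[0] by rewrite P0.
suff [] : gegenbauer lam l t = (gegp lam l).[t] /\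
       l%:R * (derive1n l.-1 G 0) / l`!%:R = (gegp1 lam l).[t] by [].
elim: l => [|l [IH IH1]].
  rewrite gegenbauer_genfun derive1n0 /G P0 powR1 gegp0 gegp10 !hornerE.
  by rewrite fact0 ?mulr1n !invr1 ?mulr1 ?mul0r.
have f0 : l`!%:R != 0 :> R by rewrite pnatr_eq0 -lt0n fact_gt0.
have l0 : l.+1%:R != 0 :> R by rewrite pnatr_eq0.
split; last first.
  rewrite /= gegp1S -IH gegenbauer_genfun factS natrM; field.
  by rewrite f0 nat1r.
apply: (mulfI l0).
rewrite gegp_rec_eval -IH -IH1 !gegenbauer_genfun factS natrM.
have [_ _] := genfun_ode l P0'; rewrite P0 mul1r => ->.
by field; rewrite f0 nat1r.
Qed.
End GeneratingFunction.

(** * Series, binomial sums, and uniformly convergent series of polynomials *)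

Definition sums_to (R : realType) (u : nat -> R) (s : R) := series u @ \oo --> s.

Section SumsTo.
Variable R : realType.
Implicit Types (u v B : nat -> R) (s c q : R).

Lemma sums_to_lim u : cvgn (series u) -> sums_to u (limn (series u)).
Proof. by []. Qed.

Lemma sums_to_val u s : sums_to u s -> limn (series u) = s.
Proof. by move=> /cvg_lim; apply. Qed.

Lemma eq_sums_to u v s : u =1 v -> sums_to u s -> sums_to v s.
Proof. by move=> /funext ->. Qed.

Lemma sums_toD u v a b : sums_to u a -> sums_to v b ->
  sums_to (fun l => u l + v l) (a + b).
Proof.
move=> ua vb; rewrite /sums_to (_ : series _ = series u + series v).
  exact: cvgD.
by apply/funext => n; rewrite /series /= big_split.
Qed.

Lemma sums_toZ c u a : sums_to u a -> sums_to (fun l => c * u l) (c * a).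
Proof.
move=> ua; rewrite /sums_to (_ : series _ = cst c * series u).
  by apply: cvgM => //; exact: cvg_cst.
by apply/funext => n; rewrite /series /= [RHS]/GRing.mul /= mulr_sumr.
Qed.

Lemma sums_toN u a : sums_to u a -> sums_to (fun l => - u l) (- a).
Proof.
move=> /(sums_toZ (c := -1)); rewrite mulN1r.
by apply: eq_sums_to => l; rewrite mulN1r.
Qed.

Lemma sums_toB u v a b : sums_to u a -> sums_to v b ->
  sums_to (fun l => u l - v l) (a - b).
Proof. by move=> ua vb; apply: sums_toD => //; exact: sums_toN. Qed.

Lemma sums_to_unique u a b : sums_to u a -> sums_to u b -> a = b.
Proof. by move=> /sums_to_val <- /sums_to_val <-. Qed.

Lemma dominated_series_cvg u B : (forall l, `|u l| <= B l) -> cvgn (series B) ->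
  cvgn (series u).
Proof.
move=> uB cB; apply: normed_cvg; apply: series_le_cvg cB => // l; first exact: normr_ge0.
exact: le_trans (normr_ge0 (u l)) (uB l).
Qed.

(** The remainder is bounded by that of the dominating series: this is what makes
    the convergence of a dominated family uniform. *)
Lemma sums_to_tail u B a b N : (forall l, `|u l| <= B l) ->
  sums_to u a -> sums_to B b -> `|a - series u N| <= b - series B N.
Proof.
move=> uB ua Bb.
apply: (@ler_cvg_to _ \oo _ _ (fun M => `|series u M - series u N|)
  (fun M => series B M - series B N)).
- by apply: cvg_norm; apply: cvgB => //; exact: cvg_cst.
- by apply: cvgB => //; exact: cvg_cst.
near=> M; rewrite !sub_series_geq; [|near: M; exact: nbhs_infty_ge..].
apply: le_trans (ler_norm_sum _ _ _) _.
exact: ler_sum.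
Unshelve. all: by end_near. Qed.

Lemma sums_to_norm_le u B a b : (forall l, `|u l| <= B l) ->
  sums_to u a -> sums_to B b -> `|a| <= b.
Proof.
move=> uB ua Bb; have := sums_to_tail 0 uB ua Bb.
by rewrite /series /= !big_geq // !subr0.
Qed.

Lemma sums_to_ge0 u a : (forall l, 0 <= u l) -> sums_to u a -> 0 <= a.
Proof.
move=> u0 ua; apply: le_trans (normr_ge0 a) _.
by apply: (sums_to_norm_le _ ua ua) => l; rewrite ger0_norm.
Qed.

Lemma sums_to_ge_term u a k : (forall l, 0 <= u l) -> sums_to u a -> u k <= a.
Proof.
move=> u0 ua; rewrite -(sums_to_val ua).
apply: (@le_trans _ _ (series u k.+1)).
  by rewrite /series /= big_nat_recr //= lerDr sumr_ge0.
apply: nondecreasing_cvgn_le.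
- by apply: nondecreasing_series => *.
- by apply/cvg_ex; exists a.
Qed.

(** By Pascal's rule [1 - q] times a partial sum for [K + 1] is a partial sum for
    [K] up to one term, and that term tends to [0] because the partial sums for
    [K + 1] are thereby bounded, hence convergent. *)
Lemma sums_to_bin K q : 0 <= q < 1 ->
  sums_to (fun l => 'C(l + K, K)%:R * q ^+ l) ((1 - q) ^- K.+1).
Proof.
move=> /andP[q0 q1]; have q1' : 1 - q != 0 by rewrite gt_eqF // subr_gt0.
have q1p : 0 < 1 - q by rewrite subr_gt0.
elim: K => [|K IH].
  have := @cvg_geometric_series R 1 q; rewrite ger0_norm // mul1r expr1 => /(_ q1).
  apply: eq_sums_to => l; by rewrite bin0.
set u := fun l => _ in IH; set v := fun l => _.
have v0 l : 0 <= v l by rewrite mulr_ge0 ?exprn_ge0.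
have rec N : (1 - q) * series v N.+1 = series u N.+1 - q * v N.
  elim: N => [|N IHN].
    by rewrite /series /= !big_nat1 /u /v !add0n !binn !expr0; ring.
  rewrite /series /= big_nat_recr //= [in RHS]big_nat_recr //= mulrDr.
  rewrite -/(series v N.+1) IHN -[\sum_(0 <= i < N.+1) u i]/(series u N.+1).
  have -> : v N.+1 = u N.+1 + q * v N.
    rewrite /u /v addSn !addnS addSn binS natrD exprS.
    ring.
  ring.
have cv : cvgn (series v).
  apply: nondecreasing_is_cvgn; first by apply: nondecreasing_series => *.
  exists ((1 - q)^-1 * (1 - q) ^- K.+1) => _ [N _ <-].
  apply: (@le_trans _ _ (series v N.+1)).
    by rewrite /series /= big_nat_recr //= lerDl.
  rewrite mulrC ler_pdivlMr // mulrC rec.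
  apply: (@le_trans _ _ (series u N.+1)).
    by rewrite lerBlDr lerDl mulr_ge0.
  rewrite -(sums_to_val IH); apply: nondecreasing_cvgn_le.
  - by apply: nondecreasing_series => n _ _; rewrite /u mulr_ge0 ?exprn_ge0.
  - by apply/cvg_ex; exists ((1 - q) ^- K.+1).
have v_0 := cvg_series_cvg_0 cv.
have E : (1 - q) * limn (series v) = (1 - q) ^- K.+1 - q * 0.
  have c1 : (1 - q) * series v N.+1 @[N --> \oo] --> (1 - q) * limn (series v).
    by apply: cvgM; [exact: cvg_cst|rewrite cvg_shiftS].
  have c2 : (series u N.+1 - q * v N) @[N --> \oo] --> (1 - q) ^- K.+1 - q * 0.
    apply: cvgB; first by rewrite cvg_shiftS.
    by apply: cvgM => //; exact: cvg_cst.
  have e : (fun N => (1 - q) * series v N.+1) = (fun N => series u N.+1 - q * v N).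
    by apply/funext => N; rewrite rec.
  rewrite e in c1.
  exact: (cvg_unique (@norm_hausdorff _ R) c1 c2).
have -> : (1 - q) ^- K.+2 = limn (series v).
  apply: (mulfI q1'); rewrite E mulr0 subr0 exprS invfM mulrA mulfV //.
  by rewrite mul1r.
exact: cv.
Qed.

Lemma sums_to_poly_cvg K q : 0 <= q < 1 ->
  cvgn (series (fun l => l.+1%:R ^+ K * q ^+ l)).
Proof.
move=> q01; have /andP[q0 q1] := q01.
apply: (@series_le_cvg _ _ (fun l => K`!%:R * ('C(l + K, K)%:R * q ^+ l))).
- by move=> l; rewrite mulr_ge0 ?exprn_ge0.
- by move=> l; rewrite !mulr_ge0 ?exprn_ge0.
- move=> l; rewrite mulrA ler_wpM2r ?exprn_ge0 //.
  rewrite -natrX -natrM ler_nat mulnC bin_ffact.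
  elim: K {q01} => // K IH.
  by rewrite expnS addnS ffactSS leq_mul // ltnS leq_addr.
by have /(sums_toZ (c := K`!%:R)) h := @sums_to_bin K q q01; apply/cvg_ex; eexists; exact: h.
Qed.
End SumsTo.

Definition dominated (R : realType) (p : nat -> {poly R}) (B : nat -> R) :=
  forall l t, `|t| <= 1 -> `|(p l).[t]| <= B l.

(** Weierstrass' condition on [[-1, 1]]. *)
Definition normal_series (R : realType) (p : nat -> {poly R}) :=
  exists2 B, cvgn (series B) & dominated p B.

Definition sum_of (R : realType) (p : nat -> {poly R}) (t : R) : R :=
  limn (series (fun l => (p l).[t])).

Definition dpoly (R : realType) (p : nat -> {poly R}) : nat -> {poly R} :=
  fun l => (p l)^`().

Section NormalSeries.
Variable R : realType.
Implicit Types (p : nat -> {poly R}) (s t : R).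

Lemma normal_sums_to p t : normal_series p -> `|t| <= 1 ->
  sums_to (fun l => (p l).[t]) (sum_of p t).
Proof. by move=> [B cB pB] t1; apply: dominated_series_cvg cB => l; exact: pB. Qed.

Lemma normal_bounded p : normal_series p ->
  exists2 K, 0 <= K & forall t, `|t| <= 1 -> `|sum_of p t| <= K.
Proof.
move=> np; have [B cB pB] := np.
exists (limn (series B)) => [|t t1].
  apply: (sums_to_ge0 (u := B)) => // l.
  by apply: le_trans (pB l 0 _); rewrite ?normr_ge0 ?normr0.
by apply: (sums_to_norm_le _ (normal_sums_to np t1) cB) => l; exact: pB.
Qed.

Lemma normal_uniform p : normal_series p ->
  exists2 e : nat -> R, e @ \oo --> 0 &
    forall N t, `|t| <= 1 -> `|sum_of p t - (\sum_(0 <= l < N) p l).[t]| <= e N.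
Proof.
move=> np; have [B cB pB] := np.
exists (fun N => limn (series B) - series B N) => [|N t t1].
  rewrite -[X in _ --> X](subrr (limn (series B))).
  by apply: cvgB => //; exact: cvg_cst.
rewrite horner_sum.
by apply: (sums_to_tail N _ (normal_sums_to np t1) cB) => l; exact: pB.
Qed.

Lemma poly_lipschitz_le (q : {poly R}) B s t :
  (forall x, `|x| <= 1 -> `|q^`().[x]| <= B) -> `|s| <= 1 -> `|t| <= 1 ->
  `|q.[s] - q.[t]| <= B * `|s - t|.
Proof.
move=> qB; wlog lt_ts : s t / t < s => [H|] s1 t1.
  have [ts|st|->] := ltgtP t s; first exact: H.
    by rewrite distrC (distrC s); exact: H.
  by rewrite !subrr !normr0 mulr0.
have [c] := poly_mvt q lt_ts; rewrite in_itv /= => /andP[tc cs] ->.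
rewrite normrM ler_wpM2r // qB // ler_norml.
by move: s1 t1; rewrite !ler_norml; lra.
Qed.

Lemma poly_taylor1_le (q : {poly R}) B s t :
  (forall x, `|x| <= 1 -> `|q^`()^`().[x]| <= B) -> `|s| <= 1 -> `|t| <= 1 ->
  `|q.[s] - q.[t] - (s - t) * q^`().[t]| <= B * (s - t) ^+ 2.
Proof.
move=> qB s1 t1.
have [st|ts|->] := ltgtP s t; last by rewrite !subrr mul0r subr0 normr0 expr0n mulr0.
- have [c] := poly_mvt q st; rewrite in_itv /= => /andP[sc ct] e.
  have -> : q.[s] - q.[t] - (s - t) * q^`().[t] = (s - t) * (q^`().[c] - q^`().[t]).
    by rewrite -[q.[s] - q.[t]]opprB e; ring.
  have c1 : `|c| <= 1 by move: s1 t1; rewrite !ler_norml; lra.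
  rewrite normrM; apply: le_trans (ler_wpM2l _ (poly_lipschitz_le qB c1 t1)) _ => //.
  rewrite mulrCA ler_wpM2l ?(le_trans _ (qB _ t1)) //.
  rewrite -[leRHS]ger0_norm ?sqr_ge0 // normrX expr2 ler_wpM2l //.
  by rewrite !ltr0_norm ?subr_lt0 //; lra.
- have [c] := poly_mvt q ts; rewrite in_itv /= => /andP[tc cs] e.
  have -> : q.[s] - q.[t] - (s - t) * q^`().[t] = (s - t) * (q^`().[c] - q^`().[t]).
    by rewrite e; ring.
  have c1 : `|c| <= 1 by move: s1 t1; rewrite !ler_norml; lra.
  rewrite normrM; apply: le_trans (ler_wpM2l _ (poly_lipschitz_le qB c1 t1)) _ => //.
  rewrite mulrCA ler_wpM2l ?(le_trans _ (qB _ t1)) //.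
  rewrite -[leRHS]ger0_norm ?sqr_ge0 // normrX expr2 ler_wpM2l //.
  by rewrite !gtr0_norm ?subr_gt0 //; lra.
Qed.

Lemma normal_lipschitz p : normal_series p -> normal_series (dpoly p) ->
  exists K, forall s t, `|s| <= 1 -> `|t| <= 1 ->
    `|sum_of p s - sum_of p t| <= K * `|s - t|.
Proof.
move=> np [B cB pB]; exists (limn (series B)) => s t s1 t1.
have d := sums_toB (normal_sums_to np s1) (normal_sums_to np t1).
have b : sums_to (fun l => `|s - t| * B l) (`|s - t| * limn (series B)) by exact: sums_toZ.
rewrite [leRHS]mulrC; apply: (sums_to_norm_le _ d b) => l.
by rewrite [leRHS]mulrC; apply: poly_lipschitz_le => // x; exact: pB.
Qed.

(** A first-order expansion with a quadratic remainder that is uniform up to the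
    end points [-1] and [1], which correspond to the poles of the sphere.  It plays
    the part of termwise differentiation. *)
Lemma normal_taylor1 p : normal_series p -> normal_series (dpoly p) ->
  normal_series (dpoly (dpoly p)) ->
  exists K, forall s t, `|s| <= 1 -> `|t| <= 1 ->
    `|sum_of p s - sum_of p t - (s - t) * sum_of (dpoly p) t| <= K * (s - t) ^+ 2.
Proof.
move=> np ndp [B cB pB]; exists (limn (series B)) => s t s1 t1.
have d := sums_toB (sums_toB (normal_sums_to np s1) (normal_sums_to np t1))
   (sums_toZ (c := s - t) (normal_sums_to ndp t1)).
have b : sums_to (fun l => (s - t) ^+ 2 * B l) ((s - t) ^+ 2 * limn (series B)) by exact: sums_toZ.
rewrite [leRHS]mulrC; apply: (sums_to_norm_le _ d b) => l.
by rewrite [leRHS]mulrC; apply: poly_taylor1_le => // x; exact: pB.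
Qed.

End NormalSeries.

(** * Integrals of zonal functions *)

(** Up to the mass of [S^m], the integral over [S^(m+1)] of [phi (x_0)]. *)
Definition zonal_integral (R : realType) (m : nat) (phi : R -> R) : R :=
  \int[@lebesgue_measure R]_(t in `[0, pi]) (sin t ^+ m * phi (cos t)).

Section ZonalIntegral.
Variables (R : realType) (m : nat).
Implicit Types (f g phi psi : R -> R) (c : R) (p : {poly R}).
Local Notation J := (@zonal_integral R m).
Local Notation mu := (@lebesgue_measure R).

Lemma integrable_0pi f : continuous f -> mu.-integrable `[0, pi] (EFin \o f).
Proof.
move=> cf; apply: continuous_compact_integrable; first exact: segment_compact.
exact: continuous_subspaceT.
Qed.

Lemma continuous_sinXM phi : continuous (phi \o cos) ->
  continuous (fun t : R => sin t ^+ m * phi (cos t)).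
Proof.
move=> cphi t; apply: (@cvgM _ _ _ _ (fun t : R => sin t ^+ m)); last exact: cphi.
apply: (@continuous_comp _ _ _ sin (@GRing.exp R ^~ m)).
  exact: continuous_sin.
exact: exprn_continuous.
Qed.

Lemma integrable_zonal phi : continuous (phi \o cos) ->
  mu.-integrable `[0, pi] (EFin \o (fun t : R => sin t ^+ m * phi (cos t))).
Proof. by move=> /continuous_sinXM/integrable_0pi. Qed.

Lemma eq_zonal phi psi : (forall t, `|t| <= 1 -> phi t = psi t) -> J phi = J psi.
Proof.
move=> e; apply: eq_Rintegral => t _; rewrite e // ler_norml.
by rewrite cos_geN1 cos_le1.
Qed.

Lemma zonalD phi psi : continuous (phi \o cos) -> continuous (psi \o cos) ->
  J (fun t => phi t + psi t) = J phi + J psi.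
Proof.
move=> cf cg; rewrite /zonal_integral -RintegralD //; try exact: integrable_zonal.
by apply: eq_Rintegral => t _; rewrite mulrDr.
Qed.

Lemma zonalZ c phi : continuous (phi \o cos) ->
  J (fun t => c * phi t) = c * J phi.
Proof.
move=> cf; rewrite /zonal_integral -RintegralZl //; last exact: integrable_zonal.
by apply: eq_Rintegral => t _; rewrite mulrCA.
Qed.

Lemma zonal_norm_le c phi : continuous (phi \o cos) ->
  (forall t, `|t| <= 1 -> `|phi t| <= c) -> `|J phi| <= c * pi.
Proof.
move=> cf fc; have ip := integrable_zonal cf.
apply: le_trans (le_normr_Rintegral _ ip) _ => //.
apply: (@le_trans _ _ (\int[mu]_(t in `[0, pi]) (cst c) t)).
  apply: le_Rintegral => //.
  - apply: integrable_0pi => t.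
    by apply: cvg_norm; exact: (continuous_sinXM cf).
  - apply: integrable_0pi; exact: cst_continuous.
  move=> t _; rewrite normrM normrX -[leRHS]mul1r.
  apply: ler_pM => //.
    by rewrite exprn_ile1 // ler_norml sin_geN1 sin_le1.
  by apply: fc; rewrite ler_norml cos_geN1 cos_le1.
rewrite Rintegral_cst //= lebesgue_measure_itv /= lte_fin pi_gt0.
by rewrite -EFinB subr0.
Qed.

Lemma integral_is_derive (F f : R -> R) :
  (forall t : R, is_derive t (1 : R) F (f t)) -> continuous f ->
  \int[mu]_(t in `[0, pi]) f t = F pi - F 0.
Proof.
move=> dF cf; rewrite /Rintegral (@continuous_FTC2 _ f F) //.
- exact: pi_gt0.
- exact: continuous_subspaceT.
- have cF : continuous F.
    by move=> t; apply/differentiable_continuous/derivable1_diffP; case: (dF t).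
  split; first by move=> t _; case: (dF t).
    exact/cvg_at_right_filter/cF.
  exact/cvg_at_left_filter/cF.
- by move=> t _; rewrite derive1E; case: (dF t).
Qed.

Lemma continuous_horner_cos p : continuous (horner p \o cos).
Proof. by move=> t; apply: continuous_comp; [exact: continuous_cos|exact: continuous_horner]. Qed.

Lemma zonal_hornerD p q : J (horner (p + q)) = J (horner p) + J (horner q).
Proof.
rewrite -zonalD; try exact: continuous_horner_cos.
by apply: eq_zonal => t _; rewrite hornerD.
Qed.

Lemma zonal_hornerZ c p : J (horner (c%:P * p)) = c * J (horner p).
Proof.
rewrite -zonalZ; last exact: continuous_horner_cos.
by apply: eq_zonal => t _; rewrite hornerM hornerC.
Qed.

Lemma zonal_horner0 : J (horner 0) = 0.
Proof. by have := zonal_hornerZ 0 0; rewrite mulr0 mul0r. Qed.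

Lemma zonal_hornerN p : J (horner (- p)) = - J (horner p).
Proof. by apply/eqP; rewrite -addr_eq0 -zonal_hornerD addNr zonal_horner0. Qed.

Lemma zonal_hornerB p q : J (horner (p - q)) = J (horner p) - J (horner q).
Proof. by rewrite zonal_hornerD zonal_hornerN. Qed.

Lemma is_derive_horner_cos p t :
  is_derive t (1 : R) (fun s : R => p.[cos s]) (- sin t * p^`().[cos t]).
Proof.
have d1 := is_derive_cos t; have d2 := is_derive_poly p (cos t).
by have := is_derive1_comp d2 d1; rewrite mulrC.
Qed.

Lemma is_derive_sinX k t :
  is_derive t (1 : R) (fun s : R => sin s ^+ k.+1) (k.+1%:R * sin t ^+ k * cos t).
Proof.
have d1 := is_derive_sin t.
rewrite (_ : (fun s => _) = sin ^+ k.+1); last by apply/funext => s; rewrite exprfctE.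
by apply: is_derive_eq.
Qed.

(** The integrand is the derivative of [sin^(m+1) p(cos)], which vanishes at [0]
    and [pi]. *)
Lemma zonal_exact p :
  J (horner (m.+1%:R * 'X * p - (1 - 'X ^+ 2) * p^`())) = 0.
Proof.
pose F (t : R) := sin t ^+ m.+1 * p.[cos t].
pose f (t : R) := sin t ^+ m * (m.+1%:R * 'X * p - (1 - 'X ^+ 2) * p^`()).[cos t].
have dF (t : R) : is_derive t (1 : R) F (f t).
  apply: is_derive_eq (is_derive_ptM (is_derive_sinX m t) (is_derive_horner_cos p t)) _.
  rewrite /f !(hornerE, horner_natr) /= exprS.
  transitivity (sin t ^+ m * (m.+1%:R * cos t * p.[cos t] - sin t ^+ 2 * p^`().[cos t])).
    by ring.
  by rewrite sin2cos2 !expr2.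
have cf : continuous f by apply: continuous_sinXM; exact: continuous_horner_cos.
rewrite /zonal_integral (integral_is_derive dF cf).
by rewrite /F sinpi sin0 !expr0n /= !mul0r subrr.
Qed.

End ZonalIntegral.

Section ZonalMass.
Variable R : realType.
Local Notation J := (@zonal_integral R).

Lemma zonal_integralSS m (p : {poly R}) :
  J m.+2 (horner p) = J m (horner ((1 - 'X ^+ 2) * p)).
Proof.
apply: eq_Rintegral => t _; rewrite !hornerE /= !exprS.
have := cos2Dsin2 t; rewrite !expr2 => <-; ring.
Qed.

(** Wallis' recurrence gives the even exponents; the integrals decrease with the
    exponent, which gives the odd ones. *)
Lemma zonal_mass_gt0 m : 0 < J m (horner 1).
Proof.
have rec k : J k.+2 (horner 1) = k.+1%:R / k.+2%:R * J k (horner 1).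
  have e : k.+2%:R * J k (horner 'X^2) = J k (horner 1).
    have := @zonal_exact R k 'X; rewrite derivX => e.
    apply/eqP; rewrite -subr_eq0 -e -zonal_hornerZ -zonal_hornerB polyC_natr.
    by apply/eqP; congr (J k (horner _)); ring.
  rewrite zonal_integralSS mulr1 zonal_hornerB -e; field.
  by have k0 := ler0n R k; rewrite gt_eqF //; lra.
have even k : 0 < J k.*2 (horner 1).
  elim: k => [|k IH].
    rewrite /zonal_integral.
    rewrite (@eq_Rintegral _ _ _ _ _ (cst 1)) => [|t _]; last first.
      by rewrite double0 expr0 mul1r hornerE.
    rewrite Rintegral_cst //= lebesgue_measure_itv /= lte_fin pi_gt0.
    by rewrite -EFinB subr0 mul1r pi_gt0.
  by rewrite doubleS rec mulr_gt0 // divr_gt0.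
have mono k : J k.+1 (horner 1) <= J k (horner 1).
  apply: le_Rintegral => //; try exact/integrable_zonal/continuous_horner_cos.
  move=> t; rewrite /= in_itv /= => t0pi; rewrite hornerE !mulr1 exprS.
  by rewrite ler_piMl ?sin_le1 // exprn_ge0 // sin_ge0_pi.
have [mo|mo] := boolP (odd m); last by rewrite -(even_halfK mo).
apply: lt_le_trans (mono m); rewrite -[m.+1]even_halfK //=.
by rewrite mo.
Qed.
End ZonalMass.

(** * Integrals over the sphere *)

Section SphereIntegral.
Variable R : realType.
Local Notation J := (@zonal_integral R).

Lemma sphereP n (x : 'rV[R]_n.+1) :
  sphere R n x <-> \sum_(i < n.+1) x 0 i ^+ 2 = 1.
Proof.
rewrite /sphere /enorm /=; split=> [|->]; last by rewrite sqrtr1.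
move=> /(congr1 (fun y => y ^+ 2)); rewrite expr1n sqr_sqrtr //.
by apply: sumr_ge0 => i _; exact: sqr_ge0.
Qed.

Lemma sph_point0 m t (xi : 'rV[R]_m.+1) : sph_point t xi 0 0 = cos t.
Proof.
have := row_mxEl (\row_(_ < 1) cos t) (sin t *: xi) 0 0; rewrite [RHS]mxE => <-.
by congr (row_mx _ _ _ _); exact: val_inj.
Qed.

Lemma sph_pointS m t (xi : 'rV[R]_m.+1) i :
  sph_point t xi 0 (lift ord0 i) = sin t * xi 0 i.
Proof.
have := row_mxEr (\row_(_ < 1) cos t) (sin t *: xi) 0 i; rewrite [RHS]mxE => <-.
by congr (row_mx _ _ _ _); rewrite rshift1.
Qed.

Lemma sphere_sph_point m t (xi : 'rV[R]_m.+1) :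
  sphere R m xi -> sphere R m.+1 (sph_point t xi).
Proof.
move=> /sphereP s; apply/sphereP; rewrite big_ord_recl sph_point0.
under eq_bigr do rewrite sph_pointS exprMn.
by rewrite -mulr_sumr s mulr1 cos2Dsin2.
Qed.

Lemma eq_sphere_integral n (f g : 'rV[R]_n.+1 -> R) :
  (forall x, sphere R n x -> f x = g x) -> sphere_integral f = sphere_integral g.
Proof.
elim: n f g => [|m IH] f g fg /=.
  by rewrite !fg //; apply/sphereP; rewrite big_ord1 mxE ?sqrrN expr1n.
apply: eq_Rintegral => t _; congr (_ * _); apply: IH => xi sxi.
exact/fg/sphere_sph_point.
Qed.

Lemma zonal_cst m c : J m (fun=> c) = c * J m (horner 1).
Proof.
rewrite -zonalZ; last exact: continuous_horner_cos.
by apply: eq_zonal => t _; rewrite hornerE mulr1.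
Qed.

Definition sphere_mass n : R := sphere_integral (fun _ : 'rV[R]_n.+1 => 1).

Lemma sphere_integral_cst n c :
  sphere_integral (fun _ : 'rV[R]_n.+1 => c) = c * sphere_mass n.
Proof.
rewrite /sphere_mass; elim: n c => [|m IH] c /=; first by rewrite mulrDr mulr1.
transitivity (J m (fun=> c * sphere_integral (fun _ : 'rV[R]_m.+1 => 1))).
  by apply: eq_Rintegral => t _; rewrite IH.
rewrite zonal_cst -mulrA; congr (_ * _); rewrite -zonal_cst.
by apply: eq_Rintegral => t _; rewrite IH mul1r.
Qed.

Lemma sphere_massS m : sphere_mass m.+1 = sphere_mass m * J m (horner 1).
Proof. by rewrite -zonal_cst. Qed.

Lemma sphere_mass_gt0 n : 0 < sphere_mass n.
Proof.
elim: n => [|m IH]; first by rewrite /sphere_mass /= addr_gt0.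
by rewrite sphere_massS mulr_gt0 // zonal_mass_gt0.
Qed.

Lemma sphere_integral_zonal m phi : continuous (phi \o cos) ->
  sphere_integral (fun x : 'rV[R]_m.+2 => phi (x 0 0)) = sphere_mass m * J m phi.
Proof.
move=> cphi; rewrite -zonalZ //; apply: eq_Rintegral => t _.
rewrite [sphere_mass m * _]mulrC; congr (_ * _).
by rewrite -sphere_integral_cst; apply: eq_sphere_integral => xi _; rewrite sph_point0.
Qed.

(** The first coordinate integrates to [0] by [zonal_exact]; the others reduce to
    lower dimension. *)
Lemma sphere_integral_coord n c i :
  sphere_integral (fun x : 'rV[R]_n.+1 => c * x 0 i) = 0.
Proof.
elim: n c i => [|m IH] c i; first by rewrite /= !mxE; ring.
rewrite /=; case: (unliftP ord0 i) => [j|] ->.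
  transitivity (J m (fun=> 0)); last by rewrite zonal_cst mul0r.
  apply: eq_Rintegral => t _; rewrite -(IH (c * sin t) j).
  by congr (_ * _); apply: eq_sphere_integral => xi _; rewrite sph_pointS mulrA.
transitivity (J m (horner ((c * sphere_mass m)%:P * 'X))).
  apply: eq_Rintegral => t _; rewrite hornerM hornerC hornerX [c * _ * _]mulrAC.
  rewrite -sphere_integral_cst.
  by congr (_ * _); apply: eq_sphere_integral => xi _; rewrite sph_point0.
have := @zonal_exact R m 1; rewrite -polyC1 derivC mulr0 subr0 polyC1 mulr1.
rewrite -polyC_natr !zonal_hornerZ => /eqP.
by rewrite mulf_eq0 pnatr_eq0 => /eqP ->; rewrite mulr0.
Qed.

Lemma sphere_integral_zonal_coord m phi i :
  sphere_integral (fun x : 'rV[R]_m.+2 => x 0 (lift ord0 i) * phi (x 0 0)) = 0.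
Proof.
rewrite /=; transitivity (J m (fun=> 0)); last by rewrite zonal_cst mul0r.
apply: eq_Rintegral => t _; rewrite -(sphere_integral_coord (phi (cos t) * sin t) i).
congr (_ * _); apply: eq_sphere_integral => xi _.
by rewrite sph_pointS sph_point0; ring.
Qed.
End SphereIntegral.

(** * Orthogonality and Parseval identities *)

Lemma series_recr (V : zmodType) (u : nat -> V) N :
  series u N.+1 = series u N + u N.
Proof. by rewrite /series /= big_nat_recr. Qed.

Section UniformLimits.
Variables (R : realType) (m : nat).
Local Notation J := (@zonal_integral R m).

Lemma zonal_cvg (phi : nat -> R -> R) (phi0 : R -> R) (e : nat -> R) :
  (forall N, continuous (phi N \o cos)) -> continuous (phi0 \o cos) ->
  e @ \oo --> 0 ->
  (forall N t, `|t| <= 1 -> `|phi0 t - phi N t| <= e N) ->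
  J (phi N) @[N --> \oo] --> J phi0.
Proof.
move=> cphi cphi0 e0 phie.
have h N : `|J phi0 - J (phi N)| <= e N * pi.
  have -> : J phi0 - J (phi N) = J (fun t => phi0 t + (-1) * phi N t).
    rewrite zonalD ?zonalZ ?mulN1r //.
    move=> t; apply: (@cvgM _ _ _ _ (fun=> -1)); first exact: cvg_cst.
    exact: cphi.
  apply: zonal_norm_le => [t|t t1]; last by rewrite mulN1r; exact: phie.
  apply: cvgD; first exact: cphi0.
  by apply: (@cvgM _ _ _ _ (fun=> -1)); [exact: cvg_cst|exact: cphi].
have epi : (e N * pi) @[N --> \oo] --> (0 : R).
  by rewrite -[0](mul0r (pi : R)); apply: cvgM => //; exact: cvg_cst.
apply/cvgrPdist_le => /= d d0.
move/cvgrPdist_le : epi => /(_ _ d0); apply: filterS => N.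
rewrite sub0r normrN => le_d; apply: le_trans (h N) _.
exact: le_trans (ler_norm _) le_d.
Qed.

Lemma continuous_sum_of p : normal_series p -> normal_series (dpoly p) ->
  continuous (sum_of p \o cos : R -> R).
Proof.
move=> np ndp; have [K pK] := normal_lipschitz np ndp.
move=> t; apply/cvgrPdist_le => /= d d0.
have K0 : 0 < `|K| + 1 by rewrite ltr_wpDl.
have /cvgrPdist_le /(_ _ (divr_gt0 d0 K0)) := @continuous_cos R t.
have c1 (x : R) : `|cos x| <= 1 by rewrite ler_norml cos_geN1 cos_le1.
apply: filterS => s; rewrite ler_pdivlMr // => le_d.
apply: le_trans (pK _ _ (c1 t) (c1 s)) _; apply: le_trans le_d.
rewrite mulrC ler_wpM2l //; apply: le_trans (ler_norm _) _.
by rewrite lerDl.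
Qed.

(** Both factors are uniform limits of their partial sums, hence so is the
    product. *)
Lemma zonal_prod_cvg (w : {poly R}) p r :
  normal_series p -> normal_series (dpoly p) ->
  normal_series r -> normal_series (dpoly r) ->
  J (horner (w * (\sum_(0 <= l < N) p l) * \sum_(0 <= l < N) r l)) @[N --> \oo]
    --> J (fun t => w.[t] * sum_of p t * sum_of r t).
Proof.
move=> np ndp nr ndr.
have [e e0 pe] := normal_uniform np; have [d d0 rd] := normal_uniform nr.
have [A A0 pA] := normal_bounded np; have [B B0 rB] := normal_bounded nr.
have [K wK] : exists K, forall t, `|t| <= 1 -> `|w.[t]| <= K.
  have [K wK] := @poly_itv_bound _ w (-1) 1; exists K => t.
  by rewrite ler_norml => t1; exact: wK.
apply: (zonal_cvg (e := fun N => K * (e N * B + (A + e N) * d N))).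
- by move=> N; exact: continuous_horner_cos.
- move=> t; apply: cvgM; last exact: continuous_sum_of.
  by apply: cvgM; [exact: continuous_horner_cos|exact: continuous_sum_of].
- have -> : 0 = K * (0 * B + (A + 0) * 0) by ring.
  apply: cvgM; first exact: cvg_cst.
  apply: cvgD; first by apply: cvgM => //; exact: cvg_cst.
  by apply: cvgM => //; apply: cvgD => //; exact: cvg_cst.
move=> N t t1; rewrite !hornerM.
set P := (\sum_(_ <= _ < _) p _).[t]; set Q := (\sum_(_ <= _ < _) r _).[t].
have peN := pe N t t1; have rdN := rd N t t1.
rewrite -/P in peN; rewrite -/Q in rdN.
have -> : w.[t] * sum_of p t * sum_of r t - w.[t] * P * Q =
  w.[t] * ((sum_of p t - P) * sum_of r t + P * (sum_of r t - Q)) by ring.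
rewrite normrM ler_pM // ?wK //.
apply: le_trans (ler_normD _ _) _; rewrite !normrM lerD // ler_pM // ?rB //.
have -> : P = sum_of p t - (sum_of p t - P) by ring.
by apply: le_trans (ler_normB _ _) _; rewrite lerD // pA.
Qed.
End UniformLimits.

Section Orthogonality.
Variables (R : realType) (m : nat) (lam : R).
Hypotheses (Hlam : 2 * lam = m%:R) (lam0 : 0 < lam).
Local Notation J := (fun p => @zonal_integral R m (horner p)).
Local Notation C := (gegp lam).

Let eigen l : R := l%:R * (l%:R + 2 * lam).

Let gegp_ode' l : (1 - 'X ^+ 2) * (C l)^`()^`() =
  m.+1%:R * 'X * (C l)^`() - (eigen l)%:P * C l.
Proof.
rewrite gegp_ode /eigen polyCM polyCD !polyC_natr -[m.+1%:R]natr1.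
have -> : m%:R = 2 * lam%:P :> {poly R} by rewrite -polyC_natr -Hlam polyCM polyC_natr.
by rewrite -polyC_natr polyCM polyC_natr; ring.
Qed.

(** By [gegp_ode], [(k (k + 2 lam) - l (l + 2 lam)) C_k C_l] is the integrand of
    [zonal_exact] for the Wronskian [C_k' C_l - C_k C_l']. *)
Lemma gegp_orthogonal k l : k != l -> J (C k * C l) = 0.
Proof.
move=> kl; have ekl : eigen k - eigen l != 0.
  have -> : eigen k - eigen l = (k%:R - l%:R) * (k%:R + l%:R + 2 * lam).
    by rewrite /eigen; ring.
  rewrite mulf_neq0 ?subr_eq0 ?eqr_nat // gt_eqF //.
  by rewrite ltr_wpDl ?addr_ge0 // mulr_gt0.
apply: (mulfI ekl); rewrite mulr0 -zonal_hornerZ.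
rewrite -(@zonal_exact R m ((C k)^`() * C l - C k * (C l)^`())).
congr (zonal_integral m (horner _)).
rewrite derivB !derivM.
transitivity (C l * (m.+1%:R * 'X * (C k)^`() - (1 - 'X ^+ 2) * (C k)^`()^`())
  - C k * (m.+1%:R * 'X * (C l)^`() - (1 - 'X ^+ 2) * (C l)^`()^`())); last by ring.
by rewrite !gegp_ode' polyCB; ring.
Qed.

Let X_rec l : (2 * (l%:R + lam))%:P * ('X * C l) =
  l.+1%:R%:P * C l.+1 + (l%:R + 2 * lam - 1)%:P * gegp1 lam l.
Proof.
have := gegp_rec lam l; rewrite !(polyCM, polyCD, polyCN, polyC1, polyC_natr) => ->.
ring.
Qed.

Let X_moment k l : 2 * (l%:R + lam) * J (C k * ('X * C l)) =
  l.+1%:R * J (C k * C l.+1) + (l%:R + 2 * lam - 1) * J (C k * gegp1 lam l).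
Proof.
rewrite -!zonal_hornerZ -zonal_hornerD; congr (zonal_integral m (horner _)).
transitivity (C k * ((2 * (l%:R + lam))%:P * ('X * C l))); first by ring.
by rewrite X_rec; ring.
Qed.

Let twol_neq0 l : 2 * (l%:R + lam) != 0.
Proof. by rewrite mulf_neq0 // gt_eqF // ltr_wpDl. Qed.

Lemma gegp_moment_diag l : J (C l * ('X * C l)) = 0.
Proof.
apply: (mulfI (twol_neq0 l)); rewrite X_moment mulr0.
rewrite gegp_orthogonal ?ltn_eqF // mulr0 add0r.
case: l => [|l]; first by rewrite gegp10 mulr0 zonal_horner0 mulr0.
by rewrite gegp1S gegp_orthogonal ?gtn_eqF // mulr0.
Qed.

Lemma gegp_moment_far k l : (k.+1 < l)%N -> J (C k * ('X * C l)) = 0.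
Proof.
case: l => // l; rewrite ltnS => kl.
apply: (mulfI (twol_neq0 l.+1)); rewrite X_moment mulr0 gegp1S.
rewrite !gegp_orthogonal ?mulr0 ?addr0 ?ltn_eqF //.
by rewrite (leq_trans kl) // ltnW.
Qed.

(** The two evaluations, by the recurrence for ['X C_l] and for ['X C_(l+1)],
    determine the ratio of consecutive norms. *)
Lemma gegp_moment_next l :
  2 * (l%:R + lam) * J (C l * ('X * C l.+1)) = l.+1%:R * J (C l.+1 * C l.+1) /\
  2 * (l.+1%:R + lam) * J (C l * ('X * C l.+1)) = (l%:R + 2 * lam) * J (C l * C l).
Proof.
split.
  have -> : C l * ('X * C l.+1) = C l.+1 * ('X * C l) by ring.
  rewrite X_moment; case: l => [|l]; first by rewrite gegp10 mulr0 zonal_horner0; ring.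
  by rewrite gegp1S (@gegp_orthogonal l.+2 l) ?mulr0 ?addr0 // gtn_eqF.
rewrite X_moment gegp1S gegp_orthogonal ?ltn_eqF // mulr0 add0r.
by congr (_ * _); rewrite -natr1; ring.
Qed.

Lemma gegp_norm2 l :
  (l%:R + lam) * J (C l * C l) = lam * J 1 * (C l).[1].
Proof.
elim: l => [|l IH]; first by rewrite gegp0 add0r mulr1 hornerE mulr1.
have l1 : l.+1%:R != 0 :> R by rewrite pnatr_eq0.
apply: (mulfI l1); have [e1 e2] := gegp_moment_next l.
transitivity ((l.+1%:R + lam) * (l.+1%:R * J (C l.+1 * C l.+1))); first by ring.
rewrite -e1.
transitivity ((l%:R + lam) * (2 * (l.+1%:R + lam) * J (C l * ('X * C l.+1)))); first by ring.
rewrite e2.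
transitivity ((l%:R + 2 * lam) * ((l%:R + lam) * J (C l * C l))); first by ring.
by rewrite IH mulrCA -gegp_at1S; ring.
Qed.

Lemma gegp_next_moment l :
  2 * (l%:R + lam) * (l.+1%:R + lam) * J (C l * ('X * C l.+1)) =
  (l%:R + 2 * lam) * (lam * J 1 * (C l).[1]).
Proof.
have [_ e2] := gegp_moment_next l.
transitivity ((l%:R + lam) * (2 * (l.+1%:R + lam) * J (C l * ('X * C l.+1)))); first by ring.
by rewrite e2 -gegp_norm2; ring.
Qed.

Implicit Types a b : nat -> R.
Local Notation psum a N := (\sum_(0 <= l < N) (a l)%:P * C l).

Lemma gegp_psum_orthogonal a N l : (N <= l)%N -> J (psum a N * C l) = 0.
Proof.
elim: N => [|N IH] Nl; first by rewrite big_geq // mul0r zonal_horner0.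
rewrite big_nat_recr //= mulrDl zonal_hornerD IH ?(ltnW Nl) // -mulrA.
by rewrite zonal_hornerZ gegp_orthogonal ?ltn_eqF // mulr0 addr0.
Qed.

Lemma gegp_psum_moment a N l : (N < l)%N -> J (psum a N * ('X * C l)) = 0.
Proof.
elim: N => [|N IH] Nl; first by rewrite big_geq // mul0r zonal_horner0.
rewrite big_nat_recr //= mulrDl zonal_hornerD IH ?(ltnW Nl) // -mulrA.
by rewrite zonal_hornerZ gegp_moment_far // mulr0 addr0.
Qed.

Lemma gegp_psum_prod a b N : J (psum a N * psum b N) =
  series (fun l => a l * b l * J (C l * C l)) N.
Proof.
elim: N => [|N IH]; first by rewrite /series /= !big_geq // mul0r zonal_horner0.
rewrite series_recr -IH big_nat_recr //= big_nat_recr //=.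
have -> : (psum a N + (a N)%:P * C N) * (psum b N + (b N)%:P * C N) =
  psum a N * psum b N + (b N)%:P * (psum a N * C N)
  + (a N)%:P * (psum b N * C N) + (a N * b N)%:P * (C N * C N).
  by rewrite polyCM; ring.
by rewrite !(zonal_hornerD, zonal_hornerZ) !gegp_psum_orthogonal // !mulr0 !addr0.
Qed.

Lemma gegp_psum_moment1 a N : J ('X * psum a N.+1 * psum a N.+1) =
  series (fun l => 2 * a l * a l.+1 * J (C l * ('X * C l.+1))) N.
Proof.
elim: N => [|N IH].
  rewrite big_nat1 /series /= big_geq //.
  have -> : 'X * ((a 0)%:P * C 0) * ((a 0)%:P * C 0) =
    (a 0 ^+ 2)%:P * (C 0 * ('X * C 0)) by rewrite expr2 polyCM; ring.
  by rewrite zonal_hornerZ gegp_moment_diag mulr0.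
rewrite series_recr -IH; set P := psum a N.+1.
have -> : psum a N.+2 = P + (a N.+1)%:P * C N.+1 by rewrite big_nat_recr.
have -> : 'X * (P + (a N.+1)%:P * C N.+1) * (P + (a N.+1)%:P * C N.+1) =
  'X * P * P + (2 * a N.+1)%:P * (P * ('X * C N.+1)) +
  (a N.+1 ^+ 2)%:P * (C N.+1 * ('X * C N.+1)).
  by rewrite expr2 !polyCM polyC_natr; ring.
rewrite !(zonal_hornerD, zonal_hornerZ) gegp_moment_diag mulr0 addr0.
congr (_ + _).
have -> : P * ('X * C N.+1) = psum a N * ('X * C N.+1) + (a N)%:P * (C N * ('X * C N.+1)).
  by rewrite /P big_nat_recr //= mulrDl -mulrA.
rewrite zonal_hornerD zonal_hornerZ gegp_psum_moment //; ring.
Qed.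

Lemma gegp_parseval a b :
  let p := fun l => (a l)%:P * C l in let r := fun l => (b l)%:P * C l in
  normal_series p -> normal_series (dpoly p) ->
  normal_series r -> normal_series (dpoly r) ->
  sums_to (fun l => a l * b l * J (C l * C l))
    (zonal_integral m (fun t => sum_of p t * sum_of r t)).
Proof.
move=> p r np ndp nr ndr; have := @zonal_prod_cvg R m 1 p r np ndp nr ndr.
rewrite (@eq_zonal _ m (fun t => _ * _ * _) (fun t => sum_of p t * sum_of r t)); last first.
  by move=> t _; rewrite hornerE mul1r.
suff -> : (fun N => J (1 * psum a N * psum b N)) =
  series (fun l => a l * b l * J (C l * C l)) by [].
by apply/funext => N; rewrite mul1r gegp_psum_prod.
Qed.

(** Only neighbouring degrees interact, since ['X C_l] is a combination of
    [C_(l-1)] and [C_(l+1)]. *)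
Lemma gegp_parseval_moment a :
  let p := fun l => (a l)%:P * C l in
  normal_series p -> normal_series (dpoly p) ->
  sums_to (fun l => 2 * a l * a l.+1 * J (C l * ('X * C l.+1)))
    (zonal_integral m (fun t => t * sum_of p t * sum_of p t)).
Proof.
move=> p np ndp; have := @zonal_prod_cvg R m 'X p p np ndp np ndp.
rewrite (@eq_zonal _ m (fun t => _ * _ * _) (fun t => t * sum_of p t * sum_of p t)); last first.
  by move=> t _; rewrite hornerX.
rewrite -cvg_shiftS /sums_to /=.
suff -> : (fun N => J ('X * psum a N.+1 * psum a N.+1)) =
  series (fun l => 2 * a l * a l.+1 * J (C l * ('X * C l.+1))) by [].
by apply/funext => N; rewrite gegp_psum_moment1.
Qed.

End Orthogonality.

(** * Zonal functions: regularity and Laplace-Beltrami operator *)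

Section DirectionalChainRule.
Variables (R : realType) (V : normedModType R).

Lemma is_derive_cvg (f : V -> R) (x v : V) (l : R) :
  (h^-1 * (f (h *: v + x) - f x)) @[h --> (0 : R)^'] --> l -> is_derive x v f l.
Proof.
move=> fl; apply: DeriveDef; first by apply/cvg_ex; exists l.
exact: cvg_lim fl.
Qed.

Lemma cvg_is_derive (f : V -> R) (x v : V) (l : R) :
  is_derive x v f l -> (h^-1 * (f (h *: v + x) - f x)) @[h --> (0 : R)^'] --> l.
Proof. by case=> /cvg_ex[l' fl'] <-; rewrite /derive (cvg_lim _ fl'). Qed.

(** A chain rule that looks at the outer function only on the range of the inner
    one: the zonal profile is known on [[-1, 1]] only, and the inner function
    [x_0 / |x|] reaches the end points. *)
Lemma is_derive_chain_quad (f : V -> R) (g : R -> R) (x v : V) (df dg K : R) :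
  (forall y, `|g (f y) - g (f x) - (f y - f x) * dg| <= K * (f y - f x) ^+ 2) ->
  is_derive x v f df -> is_derive x v (fun y => g (f y)) (dg * df).
Proof.
move=> gK /cvg_is_derive fl; apply: is_derive_cvg.
pose D (h : R) := h^-1 * (f (h *: v + x) - f x).
pose E (h : R) := h^-1 * (g (f (h *: v + x)) - g (f x) - (f (h *: v + x) - f x) * dg).
have -> : (fun h : R => h^-1 * (g (f (h *: v + x)) - g (f x))) = (fun h => dg * D h + E h).
  by apply/funext => h; rewrite /D /E; ring.
rewrite -[dg * df]addr0; apply: (@cvgD _ _ _ _ _ (fun h => dg * D h) E).
  by apply: (@cvgM _ _ _ _ (fun=> dg) D); [exact: cvg_cst|exact: fl].
apply: norm_cvg0.
have id0 : `|h : R| @[h --> (0 : R)^'] --> (0 : R).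
  rewrite -[X in _ --> X](normr0 R); apply: cvg_norm.
  exact: cvg_within.
apply: (@squeeze_cvgr _ _ _ _ (fun=> 0) (fun h => K * (`|h| * (D h * D h)))).
- near=> h; rewrite normr_ge0 /= /E normrM.
  have h0 : h != 0 by near: h; exact: nbhs_dnbhs_neq.
  apply: le_trans (ler_wpM2l _ (gK _)) _ => //.
  have -> : f (h *: v + x) - f x = h * D h by rewrite /D mulrA mulfV // mul1r.
  rewrite exprMn -[h ^+ 2]real_normK ?num_real // normfV.
  rewrite le_eqVlt; apply/orP; left; apply/eqP.
  rewrite !expr2; field; by rewrite normr_eq0.
- exact: cvg_cst.
- rewrite [X in _ --> X](_ : 0 = K * (0 * (df * df))); last by ring.
  apply: (@cvgM _ _ _ _ (fun=> K) (fun h => `|h| * (D h * D h))); first exact: cvg_cst.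
  apply: (@cvgM _ _ _ _ (fun h : R => `|h|) (fun h => D h * D h)) => //.
  exact: (cvgM fl fl).
Unshelve. all: by end_near. Qed.

End DirectionalChainRule.

Section RadialProjection.
Variables (R : realType) (n : nat).
Implicit Types (x y : 'rV[R]_n.+1) (i j : 'I_n.+1).

Let e j : 'rV[R]_n.+1 := delta_mx 0 j.
Let Q y := \sum_(i < n.+1) y 0 i ^+ 2.

Lemma is_derive_coord x j i :
  is_derive x (e j) (fun y => y 0 i) (i == j)%:R.
Proof.
apply: is_derive_cvg; apply: cvg_near_cst; near=> h.
have h0 : h != 0 by near: h; exact: nbhs_dnbhs_neq.
by rewrite !mxE addrK eqxx /= mulrA mulVf // mul1r.
Unshelve. all: by end_near. Qed.

Lemma sum_delta (F : 'I_n.+1 -> R) j : \sum_(i < n.+1) (i == j)%:R * F i = F j.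
Proof.
rewrite (bigD1 j) //= eqxx mul1r big1 ?addr0 // => i /negbTE ->.
by rewrite mul0r.
Qed.

Lemma is_derive_sumsq x j : is_derive x (e j) Q (2 * x 0 j).
Proof.
have d i : is_derive x (e j) (fun y => y 0 i ^+ 2) ((i == j)%:R * (2 * x 0 i)).
  apply: is_derive_eq (is_derive_ptM (is_derive_coord x j i) (is_derive_coord x j i)) _.
  ring.
by apply: is_derive_eq (is_derive_pt_sum d) _; rewrite sum_delta.
Qed.

Lemma enorm_sqr y : enorm y ^+ 2 = Q y.
Proof. by rewrite sqr_sqrtr // sumr_ge0 // => i _; exact: sqr_ge0. Qed.

Lemma enorm_gt0 x : x != 0 -> 0 < enorm x.
Proof.
move=> x0; rewrite lt_def sqrtr_ge0 andbT; apply: contra x0 => /eqP x0.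
have := enorm_sqr x; rewrite x0 expr0n /= => /esym/eqP.
rewrite psumr_eq0 => [/allP s|i _]; last exact: sqr_ge0.
apply/eqP/rowP => i; rewrite mxE.
by have := s i (mem_index_enum _); rewrite /= sqrf_eq0 => /eqP.
Qed.

Lemma is_derive_enorm x j : x != 0 -> is_derive x (e j) (@enorm R n.+1) (x 0 j / enorm x).
Proof.
move=> /enorm_gt0 r0; have d := is_derive_sumsq x j.
have -> : x 0 j / enorm x = (2 * enorm x)^-1 * (2 * x 0 j).
  by field; rewrite gt_eqF.
apply: (is_derive_chain_quad (g := Num.sqrt) (K := (2 * enorm x ^+ 3)^-1)) d => y.
have s0 : 0 <= enorm y by exact: sqrtr_ge0.
rewrite -/(enorm y) -/(enorm x) -!enorm_sqr.
move: (enorm y) (enorm x) s0 r0 => s r s0 r0.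
(* the remainder is [- (s - r)^2 / (2 r)], and [|s - r| <= |s^2 - r^2| / r] *)
have -> : s - r - (s ^+ 2 - r ^+ 2) * (2 * r)^-1 = - ((2 * r)^-1 * (s - r) ^+ 2).
  by field; rewrite gt_eqF.
have c0 : 0 <= (2 * r)^-1 * (s - r) ^+ 2.
  by rewrite mulr_ge0 ?sqr_ge0 // invr_ge0 mulr_ge0 // ltW.
rewrite normrN ger0_norm //.
have -> : (2 * r ^+ 3)^-1 * (s ^+ 2 - r ^+ 2) ^+ 2 =
    ((2 * r)^-1 * (s - r) ^+ 2) * ((s + r) / r) ^+ 2.
  by field; rewrite gt_eqF.
rewrite ler_peMr // exprn_ege1 //.
by rewrite ler_pdivlMr // mul1r lerDr.
Qed.

Lemma is_derive_enormV x j : x != 0 ->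
  is_derive x (e j) (fun y => (enorm y)^-1) (- (x 0 j / enorm x ^+ 3)).
Proof.
move=> x0; have r0 := enorm_gt0 x0.
apply: is_derive_eq (is_derive_ptV _ (is_derive_enorm j x0)) _; first by rewrite gt_eqF.
by field; rewrite gt_eqF.
Qed.

(** The first coordinate of the radial projection to the sphere; [zonal_grad] and
    [zonal_hess] are its first and second partial derivatives. *)
Definition zonal_coord y : R := (enorm y)^-1 * y 0 0.

Definition zonal_grad i y : R :=
  (0 == i :> 'I_n.+1)%:R * (enorm y)^-1 - y 0 0 * y 0 i * (enorm y)^-1 ^+ 3.

Definition zonal_hess i j y : R :=
  - (((0 == i :> 'I_n.+1)%:R * y 0 j + (0 == j :> 'I_n.+1)%:R * y 0 i
      + (i == j)%:R * y 0 0) * (enorm y)^-1 ^+ 3)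
  + 3 * y 0 0 * y 0 i * y 0 j * (enorm y)^-1 ^+ 5.

Lemma norm_zonal_coord_le1 y : `|zonal_coord y| <= 1.
Proof.
rewrite /zonal_coord; have [->|y0] := eqVneq (enorm y) 0.
  by rewrite invr0 mul0r normr0.
have r0 : 0 < enorm y by rewrite lt_def y0 sqrtr_ge0.
rewrite normrM normfV (gtr0_norm r0) ler_pdivrMl // mulr1.
rewrite -ler_sqr ?nnegrE ?normr_ge0 ?(ltW r0) // real_normK ?num_real //.
by rewrite enorm_sqr /Q big_ord_recl lerDl sumr_ge0 // => i _; exact: sqr_ge0.
Qed.

Lemma is_derive_zonal_coord x j : x != 0 ->
  is_derive x (e j) zonal_coord (zonal_grad j x).
Proof.
move=> x0; have r0 := enorm_gt0 x0.
apply: is_derive_eq (is_derive_ptM (is_derive_enormV j x0) (is_derive_coord x j 0)) _.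
by rewrite /zonal_grad; field; rewrite gt_eqF.
Qed.

Lemma is_derive_zonal_grad x i j : x != 0 ->
  is_derive x (e j) (zonal_grad i) (zonal_hess i j x).
Proof.
move=> x0; have r0 := enorm_gt0 x0.
have d := is_derive_enormV j x0.
have d3 : is_derive x (e j) (fun y => (enorm y)^-1 ^+ 3)
    (- (3 * x 0 j * (enorm x)^-1 ^+ 5)).
  apply: is_derive_eq (is_derive_ptM d (is_derive_ptM d d)) _.
  by field; rewrite gt_eqF.
have d0 := is_derive_ptM (is_derive_coord x j 0) (is_derive_coord x j i).
apply: is_derive_eq (is_derive_ptB (is_derive_ptZ ((0 == i :> 'I_n.+1)%:R) d) (is_derive_ptM d0 d3)) _.
by rewrite /zonal_hess; field; rewrite gt_eqF.
Qed.

Lemma near_neq0 x : x != 0 -> \forall y \near x, y != 0.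
Proof. by move=> x0; apply: (@cvgr_neq0 _ _ _ (nbhs x) _ id x). Qed.

Lemma continuous_coord i : continuous (fun y : 'rV[R]_n.+1 => y 0 i).
Proof. exact: coord_continuous. Qed.

Lemma continuous_enorm : continuous (@enorm R n.+1).
Proof.
move=> x; apply: (@continuous_comp _ _ _ Q Num.sqrt); last exact: sqrt_continuous.
have cF (i : 'I_n.+1) : true -> continuous (fun y : 'rV[R]_n.+1 => y 0 i ^+ 2).
  move=> _ y.
  apply: (@continuous_comp _ _ _ (fun y : 'rV[R]_n.+1 => y 0 i) (@GRing.exp R ^~ 2)).
    exact: continuous_coord.
  exact: exprn_continuous.
exact: (continuous_big (@add_continuous R) cF).
Qed.

Lemma continuous_enormV x : x != 0 -> {for x, continuous (fun y => (enorm y)^-1)}.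
Proof.
move=> /enorm_gt0 r0; exact: (cvgV (lt0r_neq0 r0) (@continuous_enorm x)).
Qed.

Section ContinuityRules.
Variables (x : 'rV[R]_n.+1) (f h : 'rV[R]_n.+1 -> R).
Hypotheses (cf : {for x, continuous f}) (ch : {for x, continuous h}).

Lemma continuous_ptM : {for x, continuous (fun y => f y * h y)}.
Proof. exact: (cvgM cf ch). Qed.

Lemma continuous_ptD : {for x, continuous (fun y => f y + h y)}.
Proof. exact: (cvgD cf ch). Qed.

Lemma continuous_ptB : {for x, continuous (fun y => f y - h y)}.
Proof. exact: (cvgB cf ch). Qed.

Lemma continuous_ptN : {for x, continuous (fun y => - f y)}.
Proof. exact: (cvgN cf). Qed.

Lemma continuous_ptX k : {for x, continuous (fun y => f y ^+ k)}.
Proof.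
by apply: (@continuous_comp _ _ _ f (@GRing.exp R ^~ k)) => //; exact: exprn_continuous.
Qed.
End ContinuityRules.

Lemma continuous_ptC x (c : R) : {for x, continuous (fun _ : 'rV[R]_n.+1 => c)}.
Proof. exact: cst_continuous. Qed.

Lemma continuous_zonal_coord x : x != 0 -> {for x, continuous zonal_coord}.
Proof.
move=> x0; rewrite /zonal_coord.
by apply: continuous_ptM; [exact: continuous_enormV|exact: continuous_coord]. Qed.

Lemma continuous_zonal_grad i x : x != 0 -> {for x, continuous (zonal_grad i)}.
Proof.
move=> x0; have cV := continuous_enormV x0; have cc k : {for x, continuous (fun y : 'rV[R]_n.+1 => y 0 k)}.
  exact: continuous_coord.
rewrite /zonal_grad; apply: continuous_ptB.
  by apply: continuous_ptM => //; exact: continuous_ptC.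
apply: continuous_ptM; last exact: continuous_ptX.
by apply: continuous_ptM.
Qed.

Lemma continuous_zonal_hess i j x : x != 0 -> {for x, continuous (zonal_hess i j)}.
Proof.
move=> x0; have cV := continuous_enormV x0; have cc k : {for x, continuous (fun y : 'rV[R]_n.+1 => y 0 k)}.
  exact: continuous_coord.
have cZ k (c : R) : {for x, continuous (fun y : 'rV[R]_n.+1 => c * y 0 k)}.
  by apply: continuous_ptM => //; exact: continuous_ptC.
rewrite /zonal_hess; apply: continuous_ptD.
  apply: continuous_ptN; apply: continuous_ptM; last exact: continuous_ptX.
  by apply: continuous_ptD => //; apply: continuous_ptD.
apply: continuous_ptM; last exact: continuous_ptX.
by apply: continuous_ptM => //; apply: continuous_ptM.
Qed.

Lemma zonal_coord_sphere x : sphere R n x -> zonal_coord x = x 0 0.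
Proof. by rewrite /sphere /zonal_coord /= => ->; rewrite invr1 mul1r. Qed.

Lemma sum_zonal_grad_sqr x : sphere R n x ->
  \sum_(i < n.+1) zonal_grad i x ^+ 2 = 1 - x 0 0 ^+ 2.
Proof.
move=> sx; have := sx => /sphereP sx1.
transitivity (\sum_(i < n.+1) ((i == 0)%:R * (1 - 2 * x 0 0 * x 0 i) + x 0 0 ^+ 2 * x 0 i ^+ 2)).
  apply: eq_bigr => i _; rewrite /zonal_grad (sx : enorm x = 1) invr1 expr1n (eq_sym i 0).
  by case: (0 == i); rewrite ?mulr1n ?mulr0n; ring.
by rewrite big_split /= sum_delta -mulr_sumr sx1; ring.
Qed.

Lemma sum_zonal_hess x : sphere R n x ->
  \sum_(i < n.+1) zonal_hess i i x = - n%:R * x 0 0.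
Proof.
move=> sx; have := sx => /sphereP sx1.
transitivity (\sum_(i < n.+1) ((i == 0)%:R * (- 2 * x 0 i) + (- x 0 0) + 3 * x 0 0 * x 0 i ^+ 2)).
  apply: eq_bigr => i _; rewrite /zonal_hess (sx : enorm x = 1) invr1 !expr1n (eq_sym i 0) eqxx.
  by case: (0 == i); rewrite ?mulr1n ?mulr0n; ring.
rewrite !big_split /= sum_delta -mulr_sumr sx1 sumr_const card_ord -mulr_natr.
by rewrite -natr1; ring.
Qed.

End RadialProjection.

Section ZonalC2.
Variables (R : realType) (n : nat) (g g1 g2 : R -> R) (K0 K1 L1 L2 : R).
Implicit Types (x y : 'rV[R]_n.+1) (i j : 'I_n.+1).
Hypothesis taylor0 : forall s t, `|s| <= 1 -> `|t| <= 1 ->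
  `|g s - g t - (s - t) * g1 t| <= K0 * (s - t) ^+ 2.
Hypothesis taylor1 : forall s t, `|s| <= 1 -> `|t| <= 1 ->
  `|g1 s - g1 t - (s - t) * g2 t| <= K1 * (s - t) ^+ 2.
Hypothesis lip1 : forall s t, `|s| <= 1 -> `|t| <= 1 ->
  `|g1 s - g1 t| <= L1 * `|s - t|.
Hypothesis lip2 : forall s t, `|s| <= 1 -> `|t| <= 1 ->
  `|g2 s - g2 t| <= L2 * `|s - t|.

Let f x := g (x 0 0).
Let tau := @zonal_coord R n.

Let hom_extE : hom_ext f = (fun y => g (tau y)).
Proof. by apply/funext => y; rewrite /hom_ext /f mxE. Qed.

Let near_is_derive x i (F dF : 'rV[R]_n.+1 -> R) (l : R) : x != 0 ->
  (forall y, y != 0 -> dF y = F y) ->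
  is_derive x (delta_mx 0 i) dF l -> is_derive x (delta_mx 0 i) F l.
Proof.
move=> x0 e; apply: near_eq_is_derive.
by apply: filterS (near_neq0 x0) => y /e.
Qed.

Lemma is_derive_zonal x i : x != 0 ->
  is_derive x (delta_mx 0 i) (hom_ext f) (g1 (tau x) * zonal_grad i x).
Proof.
move=> x0; rewrite hom_extE.
apply: is_derive_chain_quad (is_derive_zonal_coord i x0) => y.
by apply: taylor0; exact: norm_zonal_coord_le1.
Qed.

Let hessian i j x := g2 (tau x) * zonal_grad j x * zonal_grad i x + g1 (tau x) * zonal_hess i j x.

Lemma is_derive2_zonal x i j : x != 0 ->
  is_derive x (delta_mx 0 j) (partial i (hom_ext f)) (hessian i j x).
Proof.
move=> x0; apply: (near_is_derive (dF := fun y => g1 (tau y) * zonal_grad i y)) => //.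
  by move=> y y0; rewrite /partial; case: (is_derive_zonal i y0) => _ ->.
have d : is_derive x (delta_mx 0 j) (fun y => g1 (tau y)) (g2 (tau x) * zonal_grad j x).
  apply: is_derive_chain_quad (is_derive_zonal_coord j x0) => y.
  by apply: taylor1; exact: norm_zonal_coord_le1.
apply: is_derive_eq (is_derive_ptM d (is_derive_zonal_grad i j x0)) _.
by rewrite /hessian; ring.
Qed.

Let continuous_lip (h : R -> R) L x : x != 0 ->
  (forall s t, `|s| <= 1 -> `|t| <= 1 -> `|h s - h t| <= L * `|s - t|) ->
  {for x, continuous (fun y => h (tau y))}.
Proof.
move=> x0 lip; apply/(@cvgrPdist_le _ _ _ (nbhs x) (nbhs_filter x)) => /= d d0.
have k0 : 0 < `|L| + 1 by rewrite ltr_wpDl.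
have /(@cvgrPdist_le _ _ _ (nbhs x) (nbhs_filter x)) /(_ _ (divr_gt0 d0 k0)) :=
  continuous_zonal_coord x0.
apply: filterS => y; rewrite ler_pdivlMr // => le_d.
apply: le_trans (lip _ _ _ _) _; try exact: norm_zonal_coord_le1.
apply: le_trans le_d; rewrite mulrC ler_wpM2l //.
by apply: le_trans (ler_norm _) _; rewrite lerDl.
Qed.

(** The second partial derivatives are built from the continuous functions
    [g1 (x_0 / |x|)], [g2 (x_0 / |x|)], [zonal_grad] and [zonal_hess]. *)
Lemma zonal_sphere_C2 : sphere_C2 f.
Proof.
move=> x x0 i j; split.
- by case: (is_derive_zonal i x0).
- by case: (is_derive2_zonal i j x0).
have ch : {for x, continuous (hessian i j)}.
  rewrite /hessian; apply: continuous_ptD; last first.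
    by apply: continuous_ptM; [exact: continuous_lip lip1|exact: continuous_zonal_hess].
  apply: continuous_ptM; last exact: continuous_zonal_grad.
  by apply: continuous_ptM; [exact: continuous_lip lip2|exact: continuous_zonal_grad].
have e y : y != 0 -> hessian i j y = partial j (partial i (hom_ext f)) y.
  by move=> y0; rewrite [RHS]/partial; case: (is_derive2_zonal i j y0) => _ ->.
rewrite /prop_for /continuous_at -(e x x0).
apply: cvg_trans ch; apply: (@near_eq_cvg _ _ _ (nbhs_filter x)).
by apply: (@filterS _ _ (nbhs_filter x)) (near_neq0 x0) => y /e.
Qed.

(** The gradient of [x_0 / |x|] has squared norm [1 - x_0^2] on the sphere, and its
    Hessian has trace [- n x_0]. *)
Lemma laplace_beltrami_zonal x : sphere R n x ->
  laplace_beltrami f x = (1 - x 0 0 ^+ 2) * g2 (x 0 0) - n%:R * x 0 0 * g1 (x 0 0).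
Proof.
move=> sx; have x0 : x != 0.
  apply/eqP => x0; have /sphereP := sx; rewrite x0 big1 => [|i _]; last by rewrite mxE expr0n.
  by move=> /esym/eqP; rewrite oner_eq0.
rewrite /laplace_beltrami.
under eq_bigr => i _.
  rewrite [partial i _]/partial; case: (is_derive2_zonal i i x0) => _ ->.
  rewrite /hessian -mulrA -expr2 /tau (zonal_coord_sphere sx). over.
rewrite big_split /= -!mulr_sumr sum_zonal_grad_sqr // sum_zonal_hess //; ring.
Qed.

End ZonalC2.

(** * The Abel-Poisson wavelet *)

Section NormalGegenbauerSeries.
Variables (R : realType) (lam : R).
Hypothesis lam0 : 0 < lam.

(** Each derivative raises the order by one, and the values of every order are
    bounded by a power of [l + 1]. *)
Lemma derivn_gegp_bound k mu : 0 < mu ->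
  exists K A, forall l (t : R), `|t| <= 1 ->
    `|((gegp mu l)^`(k)).[t]| <= A * l.+1%:R ^+ K.
Proof.
elim: k mu => [|k IH] mu mu0.
  have [K muK] : exists K : nat, 2 * mu <= K%:R.
    exists (Num.truncn (2 * mu)).+1; apply/ltW/truncnS_gt.
  exists K, 1 => l t t1; rewrite derivn0 mul1r.
  by apply: le_trans (norm_gegp_le _ mu0 t1) _; exact: gegp_at1_le.
have [|K [A KA]] := IH (mu + 1); first by rewrite addr_gt0.
exists K, (2 * mu * `|A|) => l t t1.
rewrite derivSn deriv_gegp.
have -> : 2 * mu%:P * gegp1 (mu + 1) l = (2 * mu) *: gegp1 (mu + 1) l.
  by rewrite -mul_polyC polyCM polyC_natr.
rewrite derivnZ hornerZ normrM gtr0_norm ?mulr_gt0 // -mulrA ler_pM2l ?mulr_gt0 //.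
case: l => [|l].
  by rewrite gegp10 -polyC0 derivnC polyC0 if_same horner0 normr0 mulr_ge0 // exprn_ge0.
rewrite gegp1S; apply: le_trans (KA l t t1) _.
apply: (@le_trans _ _ (`|A| * l.+1%:R ^+ K)).
  by rewrite ler_wpM2r ?exprn_ge0 // ler_norm.
by rewrite ler_wpM2l // lerXn2r ?nnegrE // ler_nat.
Qed.

Lemma normal_gegp (a : nat -> R) k M B q :
  0 <= q < 1 -> (forall l, `|a l| <= B * l.+1%:R ^+ M * q ^+ l) ->
  normal_series (fun l => (a l)%:P * (gegp lam l)^`(k)).
Proof.
move=> q01 aB; have /andP[q0 _] := q01.
have [K [A KA]] := derivn_gegp_bound k lam0.
exists (fun l => (B * A) * (l.+1%:R ^+ (M + K) * q ^+ l)).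
  have c := sums_toZ (c := B * A) (sums_to_lim (@sums_to_poly_cvg _ (M + K)%N _ q01)).
  by apply/cvg_ex; eexists; exact: c.
move=> l t t1; rewrite hornerM hornerC normrM.
have -> : B * A * (l.+1%:R ^+ (M + K) * q ^+ l) =
  (B * l.+1%:R ^+ M * q ^+ l) * (A * l.+1%:R ^+ K) by rewrite exprD; ring.
by apply: ler_pM => //; exact: KA.
Qed.

Lemma dpoly_gegp (a : nat -> R) k :
  dpoly (fun l => (a l)%:P * (gegp lam l)^`(k)) =
  (fun l => (a l)%:P * (gegp lam l)^`(k.+1)).
Proof.
by apply/funext => l; rewrite /dpoly derivM derivC mul0r add0r derivnS.
Qed.

End NormalGegenbauerSeries.

(** Here and below the dimension of the sphere is [n = d + 2]. *)
Definition ap_coef (R : realType) (d : nat) (rho : R) (l : nat) : R :=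
  (glam R d.+2 + l%:R) / glam R d.+2 * Num.sqrt (2 * l%:R * rho)
  * expR (- (l%:R * rho)).

Definition ap_laplace_coef (R : realType) (d : nat) (rho : R) (l : nat) : R :=
  - (l%:R * (l%:R + d.+1%:R)) * ap_coef d rho l.

Section AbelPoisson.
Variables (R : realType) (d : nat) (rho : R).
Hypothesis rho0 : 0 < rho.
Local Notation lam := (glam R d.+2).
Local Notation ap := (@abel_poisson R d.+2 rho).
Local Notation a := (ap_coef d rho).

Lemma glamE : 2 * lam = d.+1%:R.
Proof. by rewrite /glam -[d.+2%:R]natr1 addrK mulrC divfK // pnatr_eq0. Qed.

Lemma glam_gt0 : 0 < lam.
Proof. by rewrite -(@pmulr_rgt0 _ 2) // glamE. Qed.

Local Notation b := (ap_laplace_coef d rho).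
Local Notation P k := (fun l => (a l)%:P * (gegp lam l)^`(k)).
Local Notation r := (fun l => (b l)%:P * gegp lam l).
Local Notation J p := (@zonal_integral R d.+1 (horner p)).

Let q01 : 0 <= expR (- rho) < 1.
Proof. by rewrite expR_ge0 expR_lt1 oppr_lt0. Qed.

Lemma ap_coef_bound : exists B, forall l, `|a l| <= B * l.+1%:R ^+ 2 * expR (- rho) ^+ l.
Proof.
exists ((1 + lam^-1) * (1 + 2 * rho)) => l; have lam0 := glam_gt0.
have l0 : (0 : R) <= l%:R by rewrite ler0n.
have i0 : 0 < lam^-1 by rewrite invr_gt0.
have e1 : (lam + l%:R) / lam = 1 + l%:R * lam^-1 by field; rewrite gt_eqF.
rewrite /ap_coef e1 -expRM_natl mulrN ger0_norm; last first.
  by rewrite !mulr_ge0 ?sqrtr_ge0 ?expR_ge0 // addr_ge0 // mulr_ge0 // ltW.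
rewrite ler_wpM2r ?expR_ge0 //.
have -> : (1 + lam^-1) * (1 + 2 * rho) * l.+1%:R ^+ 2 =
  ((1 + lam^-1) * l.+1%:R) * ((1 + 2 * rho) * l.+1%:R) by ring.
have s0 : 0 <= 2 * l%:R * rho by rewrite !mulr_ge0 // ltW.
apply: ler_pM; rewrite ?sqrtr_ge0 ?addr_ge0 ?mulr_ge0 ?(ltW i0) //.
  rewrite -[l.+1%:R]natr1 -subr_ge0.
  have -> : (1 + lam^-1) * (l%:R + 1) - (1 + l%:R / lam) = l%:R + lam^-1 by ring.
  by rewrite addr_ge0 // ltW.
apply: (@le_trans _ _ (1 + 2 * l%:R * rho)); last first.
  rewrite -[l.+1%:R]natr1 -subr_ge0.
  have -> : (1 + 2 * rho) * (l%:R + 1) - (1 + 2 * l%:R * rho) = l%:R + 2 * rho by ring.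
  by rewrite addr_ge0 // mulr_ge0 // ltW.
rewrite -ler_sqr ?nnegrE ?sqrtr_ge0 ?addr_ge0 // sqr_sqrtr //.
by move: (2 * l%:R * rho) s0 => s s0; nra.
Qed.

Lemma ap_laplace_coef_bound : exists B, forall l, `|b l| <= B * l.+1%:R ^+ 4 * expR (- rho) ^+ l.
Proof.
have [B aB] := ap_coef_bound; exists (d.+1%:R * B) => l.
rewrite /ap_laplace_coef normrM normrN [`|_ * (_ + _)|]ger0_norm ?mulr_ge0 ?addr_ge0 //.
have -> : d.+1%:R * B * l.+1%:R ^+ 4 * expR (- rho) ^+ l =
  (d.+1%:R * l.+1%:R ^+ 2) * (B * l.+1%:R ^+ 2 * expR (- rho) ^+ l) by ring.
apply: ler_pM => //.
rewrite -natrX -natrD -!natrM ler_nat.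
nia.
Qed.

Let normalP k : normal_series (P k).
Proof. by have [B aB] := ap_coef_bound; apply: (normal_gegp glam_gt0 k q01 aB). Qed.

Let dpolyP k : dpoly (P k) = P k.+1.
Proof. exact: dpoly_gegp. Qed.

Lemma AP_termE (x : 'rV[R]_d.+3) : AP_term rho x = (fun l => (P 0 l).[x 0 0]).
Proof.
by apply/funext => l; rewrite /AP_term gegenbauerE hornerM hornerC derivn0.
Qed.

Lemma abel_poissonE : ap = (fun x => sum_of (P 0) (x 0 0)).
Proof. by apply/funext => x; rewrite /abel_poisson AP_termE. Qed.

Lemma sphere_coord_le1 n (x : 'rV[R]_n.+1) : sphere R n x -> `|x 0 0| <= 1.
Proof. by move=> /zonal_coord_sphere <-; exact: norm_zonal_coord_le1. Qed.

Lemma abel_poisson_cvg (x : 'rV[R]_d.+3) : sphere R d.+2 x ->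
  cvgn (series (AP_term rho x)).
Proof.
move=> /sphere_coord_le1 x1; rewrite AP_termE.
by apply/cvg_ex; eexists; exact: normal_sums_to (normalP 0) x1.
Qed.

Let ndP k : normal_series (dpoly (P k)).
Proof. by rewrite dpolyP. Qed.

Let taylorP k : exists K, forall s t, `|s| <= 1 -> `|t| <= 1 ->
  `|sum_of (P k) s - sum_of (P k) t - (s - t) * sum_of (P k.+1) t| <= K * (s - t) ^+ 2.
Proof.
have := normal_taylor1 (normalP k) (ndP k); rewrite dpolyP.
by apply; exact: ndP.
Qed.

Let lipP k : exists L, forall s t, `|s| <= 1 -> `|t| <= 1 ->
  `|sum_of (P k) s - sum_of (P k) t| <= L * `|s - t|.
Proof. exact: normal_lipschitz (normalP k) (ndP k). Qed.

Lemma abel_poisson_C2 : sphere_C2 ap.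
Proof.
have [K0 t0] := taylorP 0; have [K1 t1] := taylorP 1.
have [L1 l1] := lipP 1; have [L2 l2] := lipP 2.
by rewrite abel_poissonE; exact: (zonal_sphere_C2 t0 t1 l1 l2).
Qed.

Let normal_r : normal_series r.
Proof. by have [B bB] := ap_laplace_coef_bound; exact: (normal_gegp glam_gt0 0 q01 bB). Qed.

Let normal_dr : normal_series (dpoly r).
Proof.
rewrite [dpoly r](dpoly_gegp lam b 0).
by have [B bB] := ap_laplace_coef_bound; exact: (normal_gegp glam_gt0 1 q01 bB).
Qed.

(** The operator acts termwise, by [gegp_ode]. *)
Lemma laplace_beltrami_abel_poisson x : sphere R d.+2 x ->
  laplace_beltrami ap x = sum_of r (x 0 0).
Proof.
move=> sx; have [K0 t0] := taylorP 0; have [K1 t1] := taylorP 1.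
rewrite abel_poissonE (laplace_beltrami_zonal t0 t1 sx).
have x1 := sphere_coord_le1 sx; move: (x 0 0) x1 => t t1'.
have s1 := normal_sums_to (normalP 1) t1'; have s2 := normal_sums_to (normalP 2) t1'.
have sr := normal_sums_to normal_r t1'.
have s := sums_toB (sums_toZ (c := 1 - t ^+ 2) s2) (sums_toZ (c := d.+2%:R * t) s1).
apply: sums_to_unique s _; apply: eq_sums_to sr => l.
have := congr1 (horner^~ t) (gegp_ode lam l).
rewrite /ap_laplace_coef /= !(hornerM, hornerC).
rewrite !(hornerD, hornerN, hornerM, hornerXn, hornerX, hornerC, horner_natr) glamE.
move: ((gegp lam l)^`()^`().[t]) ((gegp lam l)^`().[t]) ((gegp lam l).[t]) => c2 c1 c0 e.
transitivity (a l * ((d.+1%:R + 1) * t * c1 - l%:R * (l%:R + d.+1%:R) * c0)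
   - a l * (d.+1%:R + 1) * t * c1); first by ring.
by rewrite -e -[d.+2%:R]natr1; ring.
Qed.

Let cP : continuous (sum_of (P 0) \o cos).
Proof. exact: continuous_sum_of (normalP 0) (ndP 0). Qed.

Let cR : continuous (sum_of r \o cos).
Proof. exact: continuous_sum_of normal_r normal_dr. Qed.

Lemma abel_poisson_mass :
  sums_to (fun l => sphere_mass R d.+1 * (a l * a l * J (gegp lam l * gegp lam l)))
    (sq_mass ap).
Proof.
rewrite /sq_mass abel_poissonE.
pose phi t := sum_of (P 0) t * sum_of (P 0) t.
have -> : sphere_integral (fun x : 'rV[R]_d.+3 => `|sum_of (P 0) (x 0 0)| ^+ 2) =
    sphere_mass R d.+1 * zonal_integral d.+1 phi.
  rewrite -(@sphere_integral_zonal R d.+1 phi).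
    by apply: eq_sphere_integral => x _; rewrite real_normK ?num_real // expr2.
  by move=> t; apply: (cvgM (@cP t) (@cP t)).
apply: sums_toZ.
exact: (gegp_parseval glamE glam_gt0 (normalP 0) (ndP 0) (normalP 0) (ndP 0)).
Qed.

Lemma abel_poisson_moment0 :
  sums_to (fun l => sphere_mass R d.+1 *
      (2 * a l * a l.+1 * J (gegp lam l * ('X * gegp lam l.+1))))
    (moment_vec ap 0 0).
Proof.
rewrite /moment_vec mxE abel_poissonE.
pose phi t := t * sum_of (P 0) t * sum_of (P 0) t.
have -> : sphere_integral (fun x : 'rV[R]_d.+3 => x 0 0 * `|sum_of (P 0) (x 0 0)| ^+ 2) =
    sphere_mass R d.+1 * zonal_integral d.+1 phi.
  rewrite -(@sphere_integral_zonal R d.+1 phi).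
    by apply: eq_sphere_integral => x _; rewrite real_normK ?num_real // expr2 mulrA.
  by move=> t; apply: (cvgM (cvgM (@continuous_cos R t) (@cP t)) (@cP t)).
apply: sums_toZ.
exact: (gegp_parseval_moment glamE glam_gt0 (normalP 0) (ndP 0)).
Qed.

Lemma abel_poisson_momentS i : moment_vec ap 0 (lift ord0 i) = 0.
Proof.
rewrite /moment_vec mxE abel_poissonE.
exact: (sphere_integral_zonal_coord (fun t => `|sum_of (P 0) t| ^+ 2) i).
Qed.

Lemma abel_poisson_laplace :
  sums_to (fun l => sphere_mass R d.+1 * (b l * a l * J (gegp lam l * gegp lam l)))
    (sphere_integral (fun x => laplace_beltrami ap x * ap x)).
Proof.
pose phi t := sum_of r t * sum_of (P 0) t.
have -> : sphere_integral (fun x => laplace_beltrami ap x * ap x) =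
    sphere_mass R d.+1 * zonal_integral d.+1 phi.
  rewrite -(@sphere_integral_zonal R d.+1 phi).
    by apply: eq_sphere_integral => x sx; rewrite laplace_beltrami_abel_poisson // abel_poissonE.
  by move=> t; apply: (cvgM (@cR t) (@cP t)).
apply: sums_toZ.
exact: (gegp_parseval glamE glam_gt0 normal_r normal_dr (normalP 0) (ndP 0)).
Qed.

End AbelPoisson.

(** * Sums of the series *)

Section ClosedForms.
Variables (R : realType) (d : nat) (rho : R).
Hypothesis rho0 : 0 < rho.
Local Notation lam := (glam R d.+2).
Local Notation ap := (@abel_poisson R d.+2 rho).
Local Notation a := (ap_coef d rho).
Local Notation J p := (@zonal_integral R d.+1 (horner p)).
Local Notation q := (expR (- (2 * rho))).
Local Notation B j l := (('C(l + (d + j), d + j))%:R : R).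

Lemma q_itv : 0 <= q < 1.
Proof. by rewrite expR_ge0 expR_lt1 oppr_lt0 mulr_gt0. Qed.

Let lamE : lam = d.+1%:R / 2.
Proof. by rewrite -glamE mulrC mulKf. Qed.

Lemma gegp_at1_bin l : (gegp lam l).[1] = B 0 l.
Proof.
elim: l => [|l IH]; first by rewrite gegp0 hornerE add0n binn.
have l0 : l.+1%:R != 0 :> R by rewrite pnatr_eq0.
apply: (mulfI l0); rewrite gegp_at1S IH glamE -natrD -!natrM; congr _%:R.
rewrite addn0 addSn addnS; have := mul_bin_down (l + d).+1 d.
by rewrite -pred_Sn => ->; congr (_ * _)%N; lia.
Qed.

Lemma binS l j : (d + j).+1%:R * B j.+1 l = (l + (d + j)).+1%:R * B j l.
Proof. by rewrite -!natrM !addnS -mul_bin_diag. Qed.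

Let c := 2 * rho * (sphere_mass R d.+1 * J 1).

Lemma c_gt0 : 0 < c.
Proof. by rewrite !mulr_gt0 ?sphere_mass_gt0 // zonal_mass_gt0. Qed.

Let expq l : expR (- (l%:R * rho)) ^+ 2 = q ^+ l.
Proof. by rewrite -!expRM_natl; congr expR; ring. Qed.

Let norm2 l : J (gegp lam l * gegp lam l) =
  d.+1%:R * J 1 * B 0 l / (2 * l%:R + d.+1%:R).
Proof.
have l0 := ler0n R l; have d0 : (0 : R) < d.+1%:R by rewrite ltr0n.
have nz : l%:R + lam != 0.
  by rewrite gt_eqF // ltr_wpDl // glam_gt0.
apply: (mulfI nz); rewrite (gegp_norm2 (glamE R d) (glam_gt0 R d)) gegp_at1_bin lamE.
by field; rewrite gt_eqF //; lra.
Qed.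

(** [a_l^2] times the squared norm of [C_l]: with [d = n - 2], the factor
    [(2 l + d + 1) / (d + 1) * binomial(l + d, d)] is the dimension of the space of
    spherical harmonics of degree [l]. *)
Lemma mass_term l :
  sphere_mass R d.+1 * (a l * a l * J (gegp lam l * gegp lam l)) =
  c * (l%:R * (2 * l%:R + d.+1%:R) / d.+1%:R * B 0 l * q ^+ l).
Proof.
have l0 := ler0n R l; have d0 : (0 : R) < d.+1%:R by rewrite ltr0n.
have sq : Num.sqrt (2 * l%:R * rho) ^+ 2 = 2 * l%:R * rho.
  by rewrite sqr_sqrtr // !mulr_ge0 // ltW.
rewrite norm2 -expq /ap_coef lamE /c.
transitivity (sphere_mass R d.+1 * ((d.+1%:R / 2 + l%:R) / (d.+1%:R / 2)) ^+ 2 *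
  Num.sqrt (2 * l%:R * rho) ^+ 2 * expR (- (l%:R * rho)) ^+ 2 *
  (d.+1%:R * J 1 * B 0 l / (2 * l%:R + d.+1%:R))); first by ring.
rewrite sq; field.
rewrite !gt_eqF //; lra.
Qed.

Definition mass_sum : R :=
  q * ((d.+3)%:R + d.+1%:R * q) / (1 - q) ^+ d.+3.

Definition laplace_sum : R :=
  d.+2%:R * d.+3%:R * q * (1 + d%:R * q + 5 * q + d.+2%:R * q ^+ 2) / (1 - q) ^+ d.+2.+3.

Let d1 : d.+1%:R = d%:R + 1 :> R. Proof. by rewrite natr1. Qed.
Let d2 : d.+2%:R = d%:R + 2 :> R. Proof. by rewrite -[d.+2]addn2 natrD. Qed.
Let d3 : d.+3%:R = d%:R + 3 :> R. Proof. by rewrite -[d.+3]addn3 natrD. Qed.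

Let sumB j : sums_to (fun l => B j l * q ^+ l) ((1 - q) ^- (d + j).+1).
Proof. exact: sums_to_bin q_itv. Qed.

Let binE j l : B j.+1 l = (l%:R + d%:R + j%:R + 1) / (d%:R + j%:R + 1) * B j l.
Proof.
have d0 := ler0n R d; have j0 := ler0n R j.
have nz : (d + j).+1%:R != 0 :> R by rewrite pnatr_eq0.
apply: (mulfI nz); rewrite binS -!natr1 !natrD addrA; field.
by rewrite gt_eqF //; lra.
Qed.

Let one_q : 1 - q != 0.
Proof. by have /andP[_ h] := q_itv; rewrite gt_eqF // subr_gt0. Qed.

(** The coefficient of [q^l] is a polynomial in [l] times [binomial(l + d, d)]; it
    is expanded in the [binomial(l + d + j, d + j)], each of which sums to
    [(1 - q)^(-(d+j+1))]. *)
Lemma abel_poisson_massE : sq_mass ap = c * mass_sum.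
Proof.
apply: sums_to_unique (@abel_poisson_mass R d rho rho0) _.
apply: (eq_sums_to (fun l => esym (mass_term l))); apply: sums_toZ.
have d0 := ler0n R d.
(* [l (2 l + d + 1)] expanded in the products [(l + d + 1) ... (l + d + j)] *)
have s := sums_toD (sums_toB (sums_toZ (c := 2 * (d%:R + 2)) (@sumB 2%N))
  (sums_toZ (c := 3 * d%:R + 5) (@sumB 1%N))) (sums_toZ (c := d%:R + 1) (@sumB 0%N)).
rewrite /mass_sum.
have -> : q * (d.+3%:R + d.+1%:R * q) / (1 - q) ^+ d.+3 =
  2 * (d%:R + 2) * (1 - q) ^- (d + 2).+1 - (3 * d%:R + 5) * (1 - q) ^- (d + 1).+1
   + (d%:R + 1) * (1 - q) ^- (d + 0).+1.
  rewrite !addnS addn0 !exprS d3 d1.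
  have Xn0 : (1 - q) ^+ d != 0 by rewrite expf_neq0.
  by field; rewrite Xn0 one_q.
apply: eq_sums_to s => l; rewrite !binE d1.
by field; rewrite !gt_eqF //; lra.
Qed.

Lemma abel_poisson_laplaceE :
  sphere_integral (fun x => laplace_beltrami ap x * ap x) = - (c * laplace_sum).
Proof.
apply: sums_to_unique (@abel_poisson_laplace R d rho rho0) _.
apply: (eq_sums_to (u := fun l => - (c * ((l%:R * (l%:R + d.+1%:R)) *
   (l%:R * (2 * l%:R + d.+1%:R) / d.+1%:R * B 0 l * q ^+ l))))).
  by move=> l; rewrite mulrCA -mass_term; rewrite /ap_laplace_coef; ring.
apply/sums_toN/sums_toZ.
have d0 := ler0n R d.
(* [l^2 (l + d + 1) (2 l + d + 1)] expanded in the same products *)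
have s := sums_toD (sums_toB (sums_toZ (c := 2 * (d%:R + 2) * (d%:R + 3) * (d%:R + 4)) (@sumB 4%N))
    (sums_toZ (c := (5 * d%:R + 17) * (d%:R + 2) * (d%:R + 3)) (@sumB 3%N)))
  (sums_toB (sums_toZ (c := (14 + 15 * (d%:R + 1) + 4 * (d%:R + 1) ^+ 2) * (d%:R + 2)) (@sumB 2%N))
    (sums_toZ (c := 2 + 5 * (d%:R + 1) + 4 * (d%:R + 1) ^+ 2 + (d%:R + 1) ^+ 3) (@sumB 1%N))).
rewrite /laplace_sum.
set S := (X in sums_to _ X) in s.
have -> : d.+2%:R * d.+3%:R * q * (1 + d%:R * q + 5 * q + d.+2%:R * q ^+ 2)
    / (1 - q) ^+ d.+2.+3 = S.
  rewrite /S !addnS addn0 !exprS d3 d2.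
  have Xn0 : (1 - q) ^+ d != 0 by rewrite expf_neq0.
  by field; rewrite Xn0 one_q.
apply: eq_sums_to s => l; rewrite !binE d1.
by field; rewrite !gt_eqF //; lra.
Qed.

Definition moment_term l : R := Num.sqrt (l%:R * l.+1%:R) * B 1 l * q ^+ l.

(** The square root comes from the product [sqrt (2 l rho) sqrt (2 (l + 1) rho)] in
    consecutive coefficients. *)
Lemma moment_termE l :
  sphere_mass R d.+1 * (2 * a l * a l.+1 * J (gegp lam l * ('X * gegp lam l.+1))) =
  c * (2 * expR (- rho)) * moment_term l.
Proof.
have l0 := ler0n R l; have d0 := ler0n R d.
have lamE' : lam = (d%:R + 1) / 2 by rewrite lamE natr1.
have h := gegp_next_moment (glamE R d) (glam_gt0 R d) l.
rewrite gegp_at1_bin in h.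
have x : J (gegp lam l * ('X * gegp lam l.+1)) =
   (l%:R + 2 * lam) * (lam * J 1 * B 0 l) / (2 * (l%:R + lam) * (l.+1%:R + lam)).
  have lam0 := glam_gt0 R d.
  have nz : 2 * (l%:R + lam) * (l.+1%:R + lam) != 0.
    by rewrite !mulf_neq0 // gt_eqF // ltr_wpDl.
  by apply: (mulfI nz); rewrite h [RHS]mulrC divfK.
have sqs : Num.sqrt (2 * l%:R * rho) * Num.sqrt (2 * l.+1%:R * rho) =
    2 * rho * Num.sqrt (l%:R * l.+1%:R).
  rewrite -sqrtrM ?mulr_ge0 ?(ltW rho0) //.
  have -> : 2 * l%:R * rho * (2 * l.+1%:R * rho) = (2 * rho) ^+ 2 * (l%:R * l.+1%:R) by ring.
  by rewrite (@sqrtrM _ ((2 * rho) ^+ 2)) ?sqr_ge0 // sqrtr_sqr gtr0_norm // mulr_gt0.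
have es : expR (- (l%:R * rho)) * expR (- (l.+1%:R * rho)) = expR (- rho) * q ^+ l.
  rewrite -expRM_natl -!expRD; congr expR; rewrite -natr1; ring.
rewrite x /ap_coef /moment_term lamE' /c binE.
transitivity (sphere_mass R d.+1 * (2 * ((((d%:R + 1) / 2 + l%:R) / ((d%:R + 1) / 2)) *
   (((d%:R + 1) / 2 + l.+1%:R) / ((d%:R + 1) / 2))) *
  (Num.sqrt (2 * l%:R * rho) * Num.sqrt (2 * l.+1%:R * rho)) *
  (expR (- (l%:R * rho)) * expR (- (l.+1%:R * rho))) *
  ((l%:R + 2 * ((d%:R + 1) / 2)) * ((d%:R + 1) / 2 * J 1 * B 0 l) /
   (2 * (l%:R + (d%:R + 1) / 2) * (l.+1%:R + (d%:R + 1) / 2))))); first by ring.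
rewrite sqs es -[l.+1%:R]natr1; field.
by rewrite !gt_eqF //; lra.
Qed.

Definition moment_sum : R := limn (series moment_term).

Lemma moment_sum_cvg : sums_to moment_term moment_sum.
Proof.
have k0 : c * (2 * expR (- rho)) != 0.
  by rewrite gt_eqF // mulr_gt0 ?c_gt0 // mulr_gt0 // expR_gt0.
have s := sums_toZ (c := (c * (2 * expR (- rho)))^-1) (@abel_poisson_moment0 R d rho rho0).
apply/sums_to_lim/cvg_ex; eexists; apply: eq_sums_to s => l.
by rewrite moment_termE mulKf.
Qed.

Lemma moment_sum_gt0 : 0 < moment_sum.
Proof.
have t0 l : 0 <= moment_term l.
  by rewrite !mulr_ge0 ?sqrtr_ge0 // exprn_ge0 // expR_ge0.
apply: lt_le_trans (sums_to_ge_term 1 t0 moment_sum_cvg).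
rewrite /moment_term !mulr_gt0 ?sqrtr_gt0 ?exprn_gt0 ?expR_gt0 //.
by rewrite ltr0n bin_gt0 leq_addl.
Qed.

Lemma abel_poisson_moment0E :
  moment_vec ap 0 0 = c * (2 * expR (- rho)) * moment_sum.
Proof.
apply: sums_to_unique (@abel_poisson_moment0 R d rho rho0) _.
by apply: (eq_sums_to (fun l => esym (moment_termE l))); apply/sums_toZ/moment_sum_cvg.
Qed.

Lemma abel_poisson_moment_neq0 : moment_vec ap != 0.
Proof.
apply/eqP => /rowP /(_ 0); rewrite abel_poisson_moment0E mxE => /eqP.
by rewrite gt_eqF // mulr_gt0 ?moment_sum_gt0 // mulr_gt0 ?c_gt0 // mulr_gt0 ?expR_gt0.
Qed.

Lemma varS_abel_poisson :
  varS ap = (mass_sum / (2 * expR (- rho) * moment_sum)) ^+ 2 - 1.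
Proof.
have c0 := c_gt0; have T0 := moment_sum_gt0; have e0 := expR_gt0 (- rho).
rewrite /varS enorm_sqr big_ord_recl big1 ?addr0 => [|i _]; last first.
  by rewrite abel_poisson_momentS // expr0n.
rewrite abel_poisson_moment0E abel_poisson_massE; congr (_ - 1); field.
by rewrite !gt_eqF.
Qed.

Lemma varM_abel_poisson : varM ap = laplace_sum / mass_sum.
Proof.
have c0 := c_gt0.
rewrite /varM abel_poisson_laplaceE abel_poisson_massE mulNr opprK.
by rewrite -mulf_div divff ?mul1r // gt_eqF.
Qed.
End ClosedForms.

(** * The bounded function alpha *)

(** The value forced by (i), as the expression to be squared there is affine in
    [alpha].  The bracket is [2 T] less the sum that replaces [sqrt (l (l + 1))] by
    [l + 1/2], with the leading singularity of this difference at [q = 1] removed. *)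
Definition ap_alpha (R : realType) (d : nat) (rho : R) : R :=
  let q := expR (- (2 * rho)) in
  rho ^+ d * (2 * moment_sum d rho - (1 + (2 * d%:R + 3) * q) / (1 - q) ^+ d.+3
              + (1 - q) ^- d.+1 / (4 * d.+1%:R)).

(** The difference of the two sides vanishes at [0] and has the nonnegative
    derivative [x^N / (1 - x)]. *)
Lemma sum_inv_le_ln (R : realType) (N : nat) (x : R) : 0 < x < 1 ->
  \sum_(0 <= l < N) x ^+ l.+1 / l.+1%:R <= - ln (1 - x).
Proof.
move=> /andP[x0 x1].
pose p : {poly R} := \sum_(0 <= l < N) (l.+1%:R^-1)%:P * 'X^(l.+1).
have dp : deriv p = \sum_(0 <= l < N) ('X^l : {poly R}).
  rewrite raddf_sum /=; apply: eq_bigr => l _.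
  rewrite derivM derivC mul0r add0r derivXn -pred_Sn.
  transitivity ((l.+1%:R^-1 * l.+1%:R)%:P * 'X^l : {poly R}).
    by rewrite polyCM polyC_natr; ring.
  by rewrite mulVf ?pnatr_eq0 // polyC1 mul1r.
have pE y : p.[y] = \sum_(0 <= l < N) y ^+ l.+1 / l.+1%:R.
  by rewrite horner_sum; apply: eq_bigr => l _; rewrite hornerM hornerC hornerXn mulrC.
rewrite -pE.
pose F (y : R) := - ln (1 - y) - p.[y].
pose dF (y : R) := (1 - y)^-1 - p^`().[y].
have FD (y : R) : y < 1 -> is_derive y (1 : R) F (dF y).
  move=> y1; apply: is_derive_ptB.
  have y1' : 0 < 1 - y by rewrite subr_gt0.
  have d1 := is_derive1_ln y1'.
  have d2 : is_derive y (1 : R) (fun y : R => 1 - y) (0 - 1).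
    by apply: (@is_derive_ptB _ _ _ _ (fun=> 1) id).
  have := is_derive_ptN (is_derive1_comp (g := fun y => 1 - y) d1 d2).
  by move=> h; apply: is_derive_eq h _; rewrite sub0r mulrN1 opprK.
have [||c] := @MVT R F dF 0 x x0.
- by move=> y; rewrite in_itv /= => /andP[_ yx]; apply: FD; exact: lt_trans x1.
- apply: derivable_within_continuous => y; rewrite in_itv /= => /andP[_ yx].
  by case: (FD y (le_lt_trans yx x1)).
rewrite in_itv /= => /andP[c0 cx].
have F0 : F 0 = 0.
  rewrite /F subr0 ln1 pE big1 ?oppr0 ?addr0 // => l _.
  by rewrite exprS !mul0r.
rewrite F0 subr0 => e.
suff : 0 <= F x by rewrite /F subr_ge0.
rewrite e subr0 mulr_ge0 ?(ltW x0) //.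
have c1 : 0 < 1 - c by rewrite subr_gt0 (lt_trans cx).
rewrite /dF dp horner_sum subr_ge0.
under eq_bigr do rewrite hornerXn.
rewrite -[leRHS]mul1r ler_pdivlMr //.
have -> : (\sum_(0 <= l < N) c ^+ l) * (1 - c) = 1 - c ^+ N.
  elim: N {p dp pE F dF FD F0 e} => [|N IH]; first by rewrite big_geq // expr0; ring.
  by rewrite big_nat_recr //= mulrDl IH exprS; ring.
by rewrite lerBlDr lerDl exprn_ge0 // ltW.
Qed.

Section AlphaBound.
Variables (R : realType) (d : nat).
Local Notation B j l := (('C(l + (d + j), d + j))%:R : R).

Let bin1 l : (d%:R + 1) * B 1 l = (l%:R + d%:R + 1) * B 0 l.
Proof.
have := @binS R d l 0; by rewrite addn0 -!natr1 natrD => ->.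
Qed.

(** With [u = sqrt (l (l + 1)) + l + 1/2] one has
    [sqrt (l (l + 1)) - (l + 1/2) = - 1 / (4 u)].  Since [u] is [2 l] up to a bounded
    error, the product with [2 (l + d + 1)] is [- 1/4] up to [O(1 / (l + 1))]. *)
Lemma sqrt_mid_bound (l : nat) :
  `|2 * (Num.sqrt (l%:R * l.+1%:R) - (l%:R + 2^-1)) * (l%:R + d%:R + 1) + 4^-1|
   <= (d%:R + 1) / l.+1%:R :> R.
Proof.
have l0 := ler0n R l; have d0 := ler0n R d.
have p0 : (0 : R) <= l%:R * l.+1%:R by rewrite mulr_ge0.
have s2 := sqr_sqrtr p0; have s0 := sqrtr_ge0 (l%:R * l.+1%:R : R).
rewrite -[l.+1%:R]natr1 in s2 s0 *.
move: (Num.sqrt _) s2 s0 => s s2 s0.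
have ls : l%:R <= s by rewrite -ler_sqr ?nnegrE // s2; nra.
have sl : s <= l%:R + 2^-1 by rewrite -ler_sqr ?nnegrE ?addr_ge0 // s2; nra.
have u0 : 0 < s + l%:R + 2^-1 by lra.
have e : s - (l%:R + 2^-1) = - (4 * (s + l%:R + 2^-1))^-1.
  have nz : s + l%:R + 2^-1 != 0 by rewrite gt_eqF.
  apply: (mulfI nz).
  transitivity (s ^+ 2 - (l%:R + 2^-1) ^+ 2); first by ring.
  rewrite s2; field.
  by rewrite gt_eqF //; lra.
rewrite e.
have -> : 2 * - (4 * (s + l%:R + 2^-1))^-1 * (l%:R + d%:R + 1) + 4^-1 =
   (s - l%:R + 2^-1 - 2 * (d%:R + 1)) / (4 * (s + l%:R + 2^-1)).
  by field; rewrite gt_eqF //; lra.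
rewrite normrM normfV [`|4 * _|]gtr0_norm ?mulr_gt0 //.
rewrite ler_pdivrMr ?mulr_gt0 // mulrAC ler_pdivlMr; last by lra.
apply: (@le_trans _ _ ((2 * (d%:R + 1)) * (l%:R + 1))).
  rewrite ler_wpM2r ?addr_ge0 // ler_norml; lra.
rewrite -[2 * _]mulrC -!mulrA ler_wpM2l ?addr_ge0 //; lra.
Qed.

Variable rho : R.
Hypothesis rho0 : 0 < rho.
Local Notation q := (expR (- (2 * rho))).

Let q01 : 0 <= q < 1 := q_itv rho0.

(** The bracket of [ap_alpha] as a single series.  Its parts cancel to leading
    order: by [sqrt_mid_bound] the coefficients are at most
    [binomial(l + d, d) / (l + 1)]. *)
Lemma alpha_series : sums_to (fun l =>
  (2 * (Num.sqrt (l%:R * l.+1%:R) - (l%:R + 2^-1)) * (l%:R + d%:R + 1) + 4^-1)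
   / (d%:R + 1) * B 0 l * q ^+ l)
  (2 * moment_sum d rho - (1 + (2 * d%:R + 3) * q) / (1 - q) ^+ d.+3
              + (1 - q) ^- d.+1 / (4 * d.+1%:R)).
Proof.
have d0 := ler0n R d.
have nz : 1 - q != 0 by case/andP: q01 => _ h; rewrite gt_eqF // subr_gt0.
have sB j : sums_to (fun l => B j l * q ^+ l) ((1 - q) ^- (d + j).+1).
  exact: sums_to_bin.
(* the middle group is [(2 l + 1) * binomial(l + d + 1, d + 1)] *)
have s := sums_toD (sums_toB (sums_toZ (c := 2) (@moment_sum_cvg R d rho rho0))
   (sums_toB (sums_toZ (c := 2 * (d%:R + 2)) (@sB 2%N)) (sums_toZ (c := 2 * d%:R + 3) (@sB 1%N))))
   (sums_toZ (c := (4 * (d%:R + 1))^-1) (@sB 0%N)).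
set S := (X in sums_to _ X) in s.
set S' := (X in sums_to _ X).
have -> : S' = S.
  rewrite /S /S' !addnS addn0 !exprS -[d.+1%:R]natr1.
  have Xn0 : (1 - q) ^+ d != 0 by rewrite expf_neq0.
  field; rewrite Xn0 nz gt_eqF //; lra.
apply: eq_sums_to s => l; rewrite /moment_term.
have l0 := ler0n R l.
have b1 : B 1 l = (l%:R + d%:R + 1) / (d%:R + 1) * B 0 l.
  have nz' : d%:R + 1 != 0 :> R by rewrite gt_eqF //; lra.
  by apply: (mulfI nz'); rewrite bin1; field.
have b2 : B 2 l = (l%:R + d%:R + 2) / (d%:R + 2) * B 1 l.
  have nz' : (d + 1).+1%:R != 0 :> R by rewrite pnatr_eq0.
  apply: (mulfI nz'); rewrite binS -!natr1 !natrD; field.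
  by rewrite gt_eqF //; lra.
rewrite b2 b1; field.
by rewrite !gt_eqF //; lra.
Qed.

Lemma alpha_dominated u S : (forall l, B 0 l / l.+1%:R * q ^+ l <= u l) ->
  sums_to u S -> `|ap_alpha d rho| <= rho ^+ d * S.
Proof.
move=> Bu sS; rewrite /ap_alpha normrM ger0_norm ?exprn_ge0 ?(ltW rho0) //.
rewrite ler_wpM2l ?exprn_ge0 ?(ltW rho0) //.
apply: (sums_to_norm_le _ alpha_series sS) => l; apply: le_trans (Bu l).
have d0 := ler0n R d; have d1 : 0 < d%:R + 1 :> R by lra.
rewrite -mulrA normrM [`|B 0 l * _|]ger0_norm; last by rewrite mulr_ge0 // exprn_ge0 // expR_ge0.
have -> : B 0 l / l.+1%:R * q ^+ l = l.+1%:R^-1 * (B 0 l * q ^+ l) by ring.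
apply: ler_wpM2r; first by rewrite mulr_ge0 // exprn_ge0 // expR_ge0.
rewrite normrM [`|(_ + 1)^-1|]ger0_norm ?invr_ge0 ?(ltW d1) // ler_pdivrMr //.
by rewrite [leRHS]mulrC; exact: sqrt_mid_bound.
Qed.

(** A linear lower bound, to compare powers of [1 - q] with powers of [rho]. *)
Lemma one_sub_q_ge M : rho <= M -> 2 * expR (- (2 * M)) * rho <= 1 - q.
Proof.
move=> rM.
have -> : 1 - q = q * (expR (2 * rho) - 1) by rewrite mulrBr -expRD addNr expR0 mulr1.
have h1 := expR_ge1Dx (2 * rho).
have h2 : expR (- (2 * M)) <= q by rewrite ler_expR; lra.
have e0 := expR_gt0 (- (2 * M)).
have -> : 2 * expR (- (2 * M)) * rho = expR (- (2 * M)) * (2 * rho) by ring.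
apply: ler_pM => //; last by rewrite lerBrDl.
by rewrite mulr_ge0 // ltW.
Qed.

End AlphaBound.

(** For [d = n - 2 > 0] the series is dominated by the one of
    [binomial(l + d - 1, d - 1)], with sum [(1 - q)^(-d)], and [rho / (1 - q)] is
    bounded. *)
Lemma alpha_bounded (R : realType) (d : nat) (M : R) : (0 < d)%N ->
  exists C : R, forall rho, 0 < rho -> rho <= M -> `|ap_alpha d rho| <= C.
Proof.
case: d => // d _; exists ((2 * expR (- (2 * M)))^-1 ^+ d.+1) => rho rho0 rM.
have q01 := q_itv rho0; set q := expR (- (2 * rho)) in q01.
have z0 : 0 < 1 - q by rewrite subr_gt0; case/andP: q01.
apply: le_trans (alpha_dominated rho0 _ (@sums_to_bin _ d _ q01)) _ => [l|].
  rewrite ler_wpM2r ?exprn_ge0 ?expR_ge0 // addn0 ler_pdivrMr ?ltr0n //.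
  rewrite -natrM ler_nat.
  have := mul_bin_diag (l + d).+1 d; rewrite -pred_Sn addnS => e.
  have h : ((l + d).+1 <= d.+1 * l.+1)%N by nia.
  by rewrite -(leq_pmul2l (ltn0Sn d)) -e; nia.
rewrite -exprVn -exprMn lerXn2r ?nnegrE ?mulr_ge0 ?invr_ge0 ?expR_ge0 ?(ltW rho0) ?(ltW z0) //.
have e0 : 0 < 2 * expR (- (2 * M)) by rewrite mulr_gt0 ?expR_gt0.
rewrite ler_pdivrMr // -ler_pdivrMl ?invr_gt0 // invrK.
exact: one_sub_q_ge.
Qed.

(** For [n = 2] the dominating coefficients are [1 / (l + 1)]: the sum is of the
    order of [- ln (1 - q)]. *)
Lemma alpha_log_bounded (R : realType) (M : R) :
  exists C : R, forall rho, 0 < rho -> rho <= M -> `|ap_alpha 0 rho| <= C * (1 + `|ln rho|).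
Proof.
exists (expR (2 * M) * (2 * M + 1)) => rho rho0 rM.
have M0 : 0 < M by exact: lt_le_trans rM.
have q01 := q_itv rho0; set q := expR (- (2 * rho)) in q01.
have z0 : 0 < 1 - q by rewrite subr_gt0; case/andP: q01.
have q0 : 0 < q by exact: expR_gt0.
have cu : cvgn (series (fun l => q ^+ l / l.+1%:R)).
  have b l : `|q ^+ l / l.+1%:R| <= 'C(l + 0, 0)%:R * q ^+ l.
    rewrite bin0 mul1r ger0_norm ?mulr_ge0 ?exprn_ge0 ?invr_ge0 ?(ltW q0) //.
    by rewrite ler_pdivrMr ?ltr0n // ler_peMr ?exprn_ge0 ?(ltW q0) // ler1n.
  by apply: dominated_series_cvg b _; apply/cvg_ex; eexists; exact: (@sums_to_bin _ 0 _ q01).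
have sS := sums_to_lim cu; set S := limn _ in sS.
have S_le : S <= q^-1 * (- ln (1 - q)).
  apply: limr_le => //; near=> N.
  rewrite ler_pdivlMl //; have q01' : 0 < q < 1 by rewrite q0; case/andP: q01.
  apply: le_trans (sum_inv_le_ln N q01').
  rewrite /series /= mulr_sumr; apply: ler_sum => l _.
  by rewrite mulrA -exprS.
apply: le_trans (alpha_dominated rho0 _ sS) _ => [l|].
  by rewrite addn0 bin0 mul1r mulrC.
rewrite expr0 mul1r; apply: le_trans S_le _.
have z1 : 1 - q <= 1 by rewrite lerBlDr lerDl ltW.
rewrite -expRN opprK -mulrA; apply: ler_pM.
- exact: expR_ge0.
- by rewrite oppr_ge0 ln_le0.
- by rewrite ler_expR; lra.
have := one_sub_q_ge rho0 rM; rewrite -/q => zb.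
have e0 := expR_gt0 (- (2 * M)).
have : ln (2 * expR (- (2 * M)) * rho) <= ln (1 - q).
  by rewrite ler_ln // posrE // !mulr_gt0.
rewrite !lnM ?posrE ?mulr_gt0 // expRK.
have l2 : 0 <= ln 2 :> R by rewrite ln_ge0 // ler1n.
have lr : - `|ln rho| <= ln rho.
  by have := ler_norm (- ln rho); rewrite normrN; lra.
have Ml : 0 <= M * `|ln rho| by rewrite mulr_ge0 // ltW.
by move=> h; lra.
Unshelve. all: by end_near. Qed.

(** * Variances and uncertainty product *)

Section ExactFormulas.
Variables (R : realType) (d : nat) (rho : R).
Hypothesis rho0 : 0 < rho.
Local Notation q := (expR (- (2 * rho))).
Local Notation N := (d%:R + 2 : R).
Local Notation T := (moment_sum d rho).

Let q0 : 0 < q. Proof. exact: expR_gt0. Qed.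
Let q_neq0 : q != 0. Proof. by rewrite gt_eqF. Qed.
Let z0 : 0 < 1 - q. Proof. by have /andP[_] := q_itv rho0; rewrite subr_gt0. Qed.
Let z_neq0 : 1 - q != 0. Proof. by rewrite gt_eqF. Qed.

Let E2 : expR (2 * rho) = q^-1. Proof. by rewrite -expRN opprK. Qed.
Let E4 : expR (4 * rho) = q^-1 ^+ 2.
Proof. by rewrite -E2 -expRM_natl; congr expR; ring. Qed.
Let e2 : expR (- rho) ^+ 2 = q.
Proof. by rewrite -expRM_natl; congr expR; ring. Qed.

Let N_E : d.+2%:R = N. Proof. by rewrite -[d.+2]addn2 natrD. Qed.
Let d1 : d.+1%:R = d%:R + 1 :> R. Proof. by rewrite natr1. Qed.
Let d3 : d.+3%:R = d%:R + 3 :> R. Proof. by rewrite -[d.+3]addn3 natrD. Qed.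

(** The left-hand side is the expression squared in (i); solving for the moment
    series turns it into a single product, visibly nonzero. *)
Lemma alpha_moment_sum :
  let A := (1 - q) ^+ d.+2 * ap_alpha d rho * rho ^+ 2 in
  rho ^+ d.+2 + 2 * (2 * (N - 1) * A - (4 * N ^+ 2 - 6 * N + 3) * rho ^+ d.+2) * expR (2 * rho)
   - (4 * (N - 1) * A + (4 * N - 5) * rho ^+ d.+2) * expR (4 * rho)
  = - (8 * (N - 1) * rho ^+ d.+2 * (1 - q) ^+ d.+3 * T / q ^+ 2).
Proof.
have d0 := ler0n R d.
rewrite /ap_alpha E2 E4 d1 !exprS expr0.
have Xn0 : (1 - q) ^+ d != 0 by rewrite expf_neq0.
move: (rho ^+ d) ((1 - q) ^+ d) Xn0 T => r X Xn0 t.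
field.
rewrite q_neq0 Xn0 z_neq0 gt_eqF //; lra.
Qed.

Lemma varS_formula :
  varS (@abel_poisson R d.+2 rho) =
  (- (8 * (N - 1) * rho ^+ d.+2 * (1 - q) ^+ d.+3 * T / q ^+ 2)) ^- 2 *
   (16 * (N - 1) ^+ 2 * (N - 1 + (N + 1) * expR (2 * rho)) ^+ 2
                      * rho ^+ (2 * d.+2) * expR (2 * rho)) - 1.
Proof.
have d0 := ler0n R d; have T0 := moment_sum_gt0 d rho0.
rewrite (varS_abel_poisson d rho0) /mass_sum E2 d1 d3; congr (_ - 1).
rewrite mulnC exprM.
have Rn0 : rho ^+ d.+2 != 0 by rewrite expf_neq0 // gt_eqF.
have Xn0 : (1 - q) ^+ d.+3 != 0 by rewrite expf_neq0.
have -> : forall x y : R, (x / (2 * expR (- rho) * y)) ^+ 2 = x ^+ 2 / (4 * q * y ^+ 2).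
  move=> x y; rewrite -e2 -[4]/(2 * 2)%:R natrM expr_div_n; congr (_ / _); ring.
move: (rho ^+ d.+2) ((1 - q) ^+ d.+3) Rn0 Xn0 T T0 => r X Rn0 Xn0 t t0.
field.
by rewrite q_neq0 Xn0 Rn0 !gt_eqF //; lra.
Qed.

Lemma varM_formula :
  varM (@abel_poisson R d.+2 rho) =
      (N * (N + 1) * (N + (N + 3) * expR (2 * rho) + expR (4 * rho)) * expR (2 * rho))
      / ((N - 1 + (N + 1) * expR (2 * rho)) * (expR (2 * rho) - 1) ^+ 2).
Proof.
have d0 := ler0n R d.
rewrite (varM_abel_poisson d rho0) /laplace_sum /mass_sum E2 E4 d1 d3 N_E.
have Xn0 : (1 - q) ^+ d != 0 by rewrite expf_neq0.
rewrite !exprS expr0; move: ((1 - q) ^+ d) Xn0 => X Xn0.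
have p1 : 0 < d%:R + 3 + (d%:R + 1) * q by rewrite addr_gt0 ?mulr_gt0 //; lra.
field.
rewrite q_neq0 Xn0 mulN1r z_neq0 andbT /=.
have -> : (N - 1) * q + (N + 1) = d%:R + 3 + (d%:R + 1) * q by ring.
by rewrite gt_eqF.
Qed.

(** [F / G] is the quotient of the mass by the length of the moment vector, with
    [G] rewritten through [alpha].  [F - G] is a cubic polynomial in
    [1 - e^(-rho)] divisible by its square, plus terms with a factor [rho^2]:
    hence the factor [rho^2]. *)
Lemma varS_scaled :
  let w := (1 - expR (- rho)) / rho in let z := (1 - q) / rho in
  let X := z ^+ d.+3 * (rho * ap_alpha d rho) in
  let G := (1 + (2 * d%:R + 3) * q) + rho ^+ 2 * (X - z ^+ 2 / (4 * (d%:R + 1))) in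
  let F := expR (- rho) * (d%:R + 3 + (d%:R + 1) * q) in
  varS (@abel_poisson R d.+2 rho) =
  rho ^+ 2 * ((d%:R * w ^+ 2 - (d%:R + 1) * w ^+ 2 * (rho * w)
     + z ^+ 2 / (4 * (d%:R + 1)) - X) * (F + G) / G ^+ 2).
Proof.
move=> w z X G F; have d0 := ler0n R d; have T0 := moment_sum_gt0 d rho0.
have r_neq0 : rho != 0 by rewrite gt_eqF.
have d1_neq0 : d%:R + 1 != 0 :> R by rewrite gt_eqF //; lra.
have GE : G = 2 * T * (1 - q) ^+ d.+3.
  rewrite /G /X /z /ap_alpha d1 expr_div_n !exprS.
  have Xn0 : (1 - q) ^+ d != 0 by rewrite expf_neq0.
  have Rn0 : rho ^+ d != 0 by rewrite expf_neq0.
  move: (rho ^+ d) ((1 - q) ^+ d) Rn0 Xn0 T => r Y Rn0 Xn0 t.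
  by field; rewrite r_neq0 z_neq0 Xn0 Rn0 d1_neq0.
have G0 : 0 < G by rewrite GE; apply: mulr_gt0; [rewrite mulr_gt0|rewrite exprn_gt0].
have FG : F - G = rho ^+ 2 * (d%:R * w ^+ 2 - (d%:R + 1) * w ^+ 2 * (rho * w)
     + z ^+ 2 / (4 * (d%:R + 1)) - X).
  rewrite {}/F {}/G {}/w in GE G0 *; clear GE G0; clearbody X; clearbody z.
  rewrite -!e2; move: (expR (- rho)) => u.
  by field; rewrite r_neq0 d1_neq0.
rewrite mulrA [rho ^+ 2 * _]mulrA -FG (varS_abel_poisson d rho0).
have -> : mass_sum d rho / (2 * expR (- rho) * T) = F / G.
  rewrite GE /mass_sum d1 d3 /F.
  have Xn0 : (1 - q) ^+ d.+3 != 0 by rewrite expf_neq0.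
  move: ((1 - q) ^+ d.+3) Xn0 T T0 => Y Yn0 t t0.
  have u0 : expR (- rho) != 0 by rewrite gt_eqF // expR_gt0.
  rewrite -!e2; move: (expR (- rho)) u0 => u u0.
  by field; rewrite u0 Yn0 gt_eqF.
by field; rewrite gt_eqF.
Qed.

Lemma varM_scaled :
  let z := (1 - q) / rho in
  varM (@abel_poisson R d.+2 rho) =
  rho ^- 2 * ((d%:R + 2) * (d%:R + 3) * (1 + d%:R * q + 5 * q + (d%:R + 2) * q ^+ 2)
    / ((d%:R + 3 + (d%:R + 1) * q) * z ^+ 2)).
Proof.
move=> z; have d0 := ler0n R d.
have r_neq0 : rho != 0 by rewrite gt_eqF.
rewrite (varM_abel_poisson d rho0) /laplace_sum /mass_sum d1 d3 N_E /z !exprS expr0.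
have Xn0 : (1 - q) ^+ d != 0 by rewrite expf_neq0.
move: ((1 - q) ^+ d) Xn0 => X Xn0.
have p1 : 0 < d%:R + 3 + (d%:R + 1) * q by rewrite addr_gt0 ?mulr_gt0 //; lra.
field.
by rewrite q_neq0 Xn0 r_neq0 z_neq0 gt_eqF.
Qed.

End ExactFormulas.

Section SmallScaleLimit.
Variables (R : realType) (d : nat).

Lemma cvg_expR_slope (k : R) : ((1 - expR (- (k * rho))) / rho) @[rho --> 0^'+] --> k.
Proof.
have d1 : is_derive (0 : R) (1 : R) (fun h : R => - (k * h)) (- (k * 1)).
  by apply: is_derive_ptN; apply: is_derive_ptZ; exact: is_derive_id.
have d2 : is_derive (0 : R) (1 : R) (fun h : R => 1 - expR (- (k * h))) k.
  have de : is_derive (- (k * 0)) (1 : R) expR (expR (- (k * 0))) by exact: is_derive_expR.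
  have dc := is_derive1_comp (g := fun h : R => - (k * h)) de d1.
  have dcst : is_derive (0 : R) (1 : R) (fun _ : R => 1 : R) 0 by exact: is_derive_cst.
  apply: is_derive_eq (is_derive_ptB dcst dc) _.
  by rewrite mulr0 oppr0 expR0 mul1r sub0r opprK mulr1.
have := cvg_is_derive d2.
have -> : (fun h : R => h^-1 * (1 - expR (- (k * (h *: (1 : R) + 0))) - (1 - expR (- (k * 0))))) =
  (fun h => (1 - expR (- (k * h))) / h).
  apply/funext => h; rewrite mulr0 oppr0 expR0 subrr subr0 addr0 mulrC.
  by rewrite /GRing.scale /= mulr1.
exact: cvg_dnbhs_at_right.
Qed.

Lemma cvg_right_id : (rho : R) @[rho --> 0^'+] --> (0 : R).
Proof. exact: cvg_at_right_filter cvg_id. Qed.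

(** [alpha] grows at most logarithmically, and [ln x < x] at [x = rho^(-1/2)] gives
    [rho |ln rho| <= 2 rho^(1/2)]. *)
Lemma cvg_rho_alpha : (rho * ap_alpha d rho) @[rho --> (0 : R)^'+] --> (0 : R).
Proof.
have [C aC] : exists C : R, forall rho, 0 < rho -> rho <= 1 ->
    `|ap_alpha d rho| <= C * (1 + `|ln rho|).
  case: (posnP d) => [->|dgt0]; first exact: alpha_log_bounded.
  have [C aC] := @alpha_bounded R d 1 dgt0; exists C => rho rho0 rho1.
  have al := aC _ rho0 rho1; apply: le_trans al _.
  by rewrite ler_peMr ?lerDl // (le_trans _ (aC _ rho0 rho1)).
apply: norm_cvg0.
apply: (@squeeze_cvgr _ _ _ _ (fun=> 0)
  (fun rho => `|C| * (Num.sqrt rho * (Num.sqrt rho + 2)))).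
- near=> rho; rewrite normr_ge0 /= normrM.
  have rho0 : 0 < rho by near: rho; exact: nbhs_right_gt.
  have rho1 : rho <= 1 by near: rho; exact: nbhs_right_le.
  set s := Num.sqrt rho; have s0 : 0 < s by rewrite sqrtr_gt0.
  have s2 : rho = s ^+ 2 by rewrite sqr_sqrtr // ltW.
  have lr : `|ln rho| <= 2 / s.
    rewrite ler0_norm ?ln_le0 // s2 lnXn // -[_ *+ 2]mulr_natl -mulrN -lnV ?posrE //.
    by rewrite ler_pM2l //; apply/ltW/ln_sublinear; rewrite invr_gt0.
  rewrite [`|rho|]gtr0_norm //.
  apply: (@le_trans _ _ (rho * (`|C| * (1 + 2 / s)))).
    rewrite ler_pM2l //; apply: le_trans (aC _ rho0 rho1) _.
    apply: (@le_trans _ _ (`|C| * (1 + `|ln rho|))).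
      by rewrite ler_wpM2r ?addr_ge0 // ler_norm.
    by rewrite ler_wpM2l // lerD2l.
  rewrite s2 le_eqVlt; apply/orP; left; apply/eqP; field.
  by rewrite gt_eqF.
- exact: cvg_cst.
have cs : Num.sqrt rho @[rho --> (0 : R)^'+] --> (0 : R).
  rewrite -[X in _ --> X](sqrtr0 R).
  by apply: cvg_at_right_filter; exact: sqrt_continuous.
rewrite [X in _ --> X](_ : 0 = `|C| * (0 * (0 + 2))); last by rewrite mul0r mulr0.
apply: cvgM; first exact: cvg_cst.
by apply: cvgM => //; apply: cvgD => //; exact: cvg_cst.
Unshelve. all: by end_near. Qed.

Lemma cvg_expR_right (k : R) : expR (- (k * rho)) @[rho --> (0 : R)^'+] --> (1 : R).
Proof.
rewrite -[X in _ --> X](expR0 R) -[X in expR X]oppr0 -{2}(mulr0 k).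
apply: cvg_at_right_filter.
have c : (- (k * rho)) @[rho --> (0 : R)] --> - (k * 0).
  by apply: cvgN; apply: cvgM; [exact: cvg_cst|exact: cvg_id].
by apply: (cvg_comp _ _ c); exact: continuous_expR.
Qed.

Definition right_lim (f : R -> R) (l : R) := f rho @[rho --> (0 : R)^'+] --> l.

Lemma right_limC c : right_lim (fun=> c) c.
Proof. exact: cvg_cst. Qed.

Lemma right_limD f g a b : right_lim f a -> right_lim g b ->
  right_lim (fun rho => f rho + g rho) (a + b).
Proof. by move=> fa gb; exact: (cvgD fa gb). Qed.

Lemma right_limB f g a b : right_lim f a -> right_lim g b ->
  right_lim (fun rho => f rho - g rho) (a - b).
Proof. by move=> fa gb; exact: (cvgB fa gb). Qed.

Lemma right_limM f g a b : right_lim f a -> right_lim g b ->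
  right_lim (fun rho => f rho * g rho) (a * b).
Proof. by move=> fa gb; exact: (cvgM fa gb). Qed.

Lemma right_limX k f a : right_lim f a ->
  right_lim (fun rho => f rho ^+ k) (a ^+ k).
Proof.
move=> fa; elim: k => [|k IH].
  rewrite expr0; suff -> : (fun rho => f rho ^+ 0) = (fun=> 1) by exact: right_limC.
  by apply/funext => rho; rewrite expr0.
rewrite exprS; suff -> : (fun rho => f rho ^+ k.+1) = (fun rho => f rho * f rho ^+ k).
  exact: right_limM.
by apply/funext => rho; rewrite exprS.
Qed.

Lemma right_limV f a : a != 0 -> right_lim f a ->
  right_lim (fun rho => (f rho)^-1) (a^-1).
Proof. by move=> a0 fa; exact: (cvgV a0 fa). Qed.

Lemma right_lim_sqrt f a : right_lim f a ->
  right_lim (fun rho => Num.sqrt (f rho)) (Num.sqrt a).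
Proof. move=> fa; exact: (@continuous_cvg _ _ _ _ _ f Num.sqrt a (@sqrt_continuous R a) fa). Qed.

Lemma right_lim_eq f a b : right_lim f a -> a = b -> right_lim f b.
Proof. by move=> fa <-. Qed.

Lemma uncertainty_limit :
  uncertainty (@abel_poisson R d.+2 rho) @[rho --> (0 : R)^'+] -->
   (Num.sqrt ((d%:R ^+ 2 + d%:R + 1) / ((d%:R + 1) * (d%:R + 2))) *
    Num.sqrt ((d%:R + 3) * (d%:R + 4) / 4) : R).
Proof.
have d0 := ler0n R d.
pose q (rho : R) : R := expR (- (2 * rho)).
pose w (rho : R) : R := (1 - expR (- rho)) / rho.
pose z (rho : R) : R := (1 - q rho) / rho.
pose X (rho : R) : R := z rho ^+ d.+3 * (rho * ap_alpha d rho).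
pose G (rho : R) : R := (1 + (2 * d%:R + 3) * q rho)
    + rho ^+ 2 * (X rho - z rho ^+ 2 / (4 * (d%:R + 1))).
pose F (rho : R) : R := expR (- rho) * (d%:R + 3 + (d%:R + 1) * q rho).
pose vS (rho : R) : R := (d%:R * w rho ^+ 2 - (d%:R + 1) * w rho ^+ 2 * (rho * w rho)
     + z rho ^+ 2 / (4 * (d%:R + 1)) - X rho) * (F rho + G rho) / G rho ^+ 2.
pose vM (rho : R) : R := (d%:R + 2) * (d%:R + 3)
    * (1 + d%:R * q rho + 5 * q rho + (d%:R + 2) * q rho ^+ 2)
    / ((d%:R + 3 + (d%:R + 1) * q rho) * z rho ^+ 2).
have cr : right_lim id 0 by exact: cvg_right_id.
have cq : right_lim q 1 by exact: cvg_expR_right.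
have cz : right_lim z 2 by exact: cvg_expR_slope.
have e1 : (fun rho : R => expR (- (1 * rho))) = (fun rho => expR (- rho)).
  by apply/funext => rho; rewrite mul1r.
have ce : right_lim (fun rho => expR (- rho)) 1 by rewrite -e1; exact: cvg_expR_right.
have cw : right_lim w 1.
  have -> : w = (fun rho => (1 - expR (- (1 * rho))) / rho).
    by apply/funext => rho; rewrite mul1r.
  exact: cvg_expR_slope.
have cX : right_lim X 0.
  by apply: right_lim_eq (right_limM (right_limX (k := d.+3%N) cz) cvg_rho_alpha) _; rewrite mulr0.
have cZ c f l : right_lim f l -> right_lim (fun rho => c * f rho) (c * l).
  by apply: right_limM; exact: right_limC.
have cz2 : right_lim (fun rho => z rho ^+ 2 / (4 * (d%:R + 1))) (1 / (d%:R + 1)).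
  apply: right_lim_eq (right_limM (right_limX (k := 2%N) cz) (@right_limC _)) _.
  by field; rewrite gt_eqF //; lra.
have cG : right_lim G (2 * (d%:R + 2)).
  apply: right_lim_eq (right_limD (right_limD (@right_limC 1) (cZ _ _ _ cq))
    (right_limM (right_limX (k := 2%N) cr) (right_limB cX cz2))) _.
  by rewrite expr0n /=; ring.
have cF : right_lim F (2 * (d%:R + 2)).
  apply: right_lim_eq (right_limM ce (right_limD (@right_limC _) (cZ _ _ _ cq))) _.
  ring.
have cvS : right_lim vS ((d%:R ^+ 2 + d%:R + 1) / ((d%:R + 1) * (d%:R + 2))).
  have G0 : (2 * (d%:R + 2)) ^+ 2 != 0 :> R by rewrite gt_eqF // exprn_gt0 //; lra.
  apply: right_lim_eq (right_limM (right_limM (right_limB (right_limD (right_limB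
    (cZ _ _ _ (right_limX (k := 2%N) cw))
    (right_limM (cZ _ _ _ (right_limX (k := 2%N) cw)) (right_limM cr cw))) cz2) cX)
    (right_limD cF cG)) (right_limV G0 (right_limX (k := 2%N) cG))) _.
  by field; rewrite !gt_eqF //; lra.
have cvM : right_lim vM ((d%:R + 3) * (d%:R + 4) / 4).
  have D0 : (d%:R + 3 + (d%:R + 1) * 1) * 2 ^+ 2 != 0 :> R by rewrite gt_eqF //; lra.
  apply: right_lim_eq (right_limM (cZ _ _ _ (right_limD (right_limD (right_limD
     (@right_limC 1) (cZ _ _ _ cq)) (cZ _ _ _ cq)) (cZ _ _ _ (right_limX (k := 2%N) cq))))
     (right_limV D0 (right_limM (right_limD (@right_limC _) (cZ _ _ _ cq)) (right_limX (k := 2%N) cz)))) _.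
  by field; rewrite !gt_eqF //; lra.
apply: cvg_trans (right_limM (right_lim_sqrt cvS) (right_lim_sqrt cvM)).
apply: near_eq_cvg; near=> rho.
have rho0 : 0 < rho by near: rho; exact: nbhs_right_gt.
have hS : varS (@abel_poisson R d.+2 rho) = rho ^+ 2 * vS rho by exact: varS_scaled.
have hM : varM (@abel_poisson R d.+2 rho) = rho^-1 ^+ 2 * vM rho.
  by rewrite exprVn; exact: varM_scaled.
rewrite /uncertainty hS hM (@sqrtrM _ (rho ^+ 2)) ?sqr_ge0 //.
rewrite (@sqrtrM _ (rho^-1 ^+ 2)) ?sqr_ge0 // !sqrtr_sqr !gtr0_norm ?invr_gt0 //.
by rewrite mulrACA mulfV ?mul1r // gt_eqF.
Unshelve. all: by end_near. Qed.

End SmallScaleLimit.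

Theorem theorem3p1 (R : realType) (n : nat) (hn : (2 <= n)%N) :
  (* the wavelet is well defined and lies in the domain of the variances *)
  (forall rho : R, 0 < rho ->
    [/\ forall x : 'rV[R]_n.+1, sphere R n x -> cvgn (series (AP_term rho x)),
        sphere_C2 (@abel_poisson R n rho) &
        moment_vec (@abel_poisson R n rho) != 0]) /\
  (* (i); alpha is bounded as rho -> 0 for n > 2, and only O(|ln rho|) for n = 2,
     where (1/8) ln rho is its actual order of growth *)
  (exists alpha : R -> R,
    [/\ ((2 < n)%N -> forall M : R, exists C : R, forall rho : R,
          0 < rho -> rho <= M -> `|alpha rho| <= C),
        (n = 2%N -> forall M : R, exists C : R, forall rho : R,
          0 < rho -> rho <= M -> `|alpha rho| <= C * (1 + `|ln rho|)) &
        forall rho : R, 0 < rho ->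
          let N : R := n%:R in
          let E2 := expR (2 * rho) in
          let E4 := expR (4 * rho) in
          let A := (1 - expR (- (2 * rho))) ^+ n * alpha rho * rho ^+ 2 in
          let D := rho ^+ n
            + 2 * (2 * (N - 1) * A - (4 * N ^+ 2 - 6 * N + 3) * rho ^+ n) * E2
            - (4 * (N - 1) * A + (4 * N - 5) * rho ^+ n) * E4 in
          D != 0 /\
          varS (@abel_poisson R n rho) =
            D ^- 2 * (16 * (N - 1) ^+ 2 * (N - 1 + (N + 1) * E2) ^+ 2
                      * rho ^+ (2 * n) * E2) - 1]) /\
  (* (ii) *)
  (forall rho : R, 0 < rho ->
    let N : R := n%:R in
    let E2 := expR (2 * rho) in
    let E4 := expR (4 * rho) in
    varM (@abel_poisson R n rho) =
      (N * (N + 1) * (N + (N + 3) * E2 + E4) * E2)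
      / ((N - 1 + (N + 1) * E2) * (E2 - 1) ^+ 2)) /\
  (* (iii) *)
  (let N : R := n%:R in
   uncertainty (@abel_poisson R n rho) @[rho --> 0^'+] -->
     (2^-1 * Num.sqrt ((N + 1) * (N + 2) * (N ^+ 2 - 3 * N + 3)
                       / (N * (N - 1))) : R)).
Proof.
case: n hn => [//|[//|d]] _; have d0 := ler0n R d.
have NE : d.+2%:R = d%:R + 2 :> R by rewrite -[d.+2]addn2 natrD.
split; [|split; [|split]].
- move=> rho rho0; split.
  + exact: abel_poisson_cvg.
  + exact: abel_poisson_C2.
  + exact: abel_poisson_moment_neq0.
- exists (ap_alpha d); split.
  + by move=> d_gt0 M; exact: alpha_bounded.
  + by move=> [->] M; exact: alpha_log_bounded.
  move=> rho rho0 N E2 E4 A D.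
  have DE : D = - (8 * (d%:R + 2 - 1) * rho ^+ d.+2 * (1 - expR (- (2 * rho))) ^+ d.+3
      * moment_sum d rho / expR (- (2 * rho)) ^+ 2).
    by rewrite -(alpha_moment_sum d rho0) /D /A /N NE.
  split; last by rewrite DE (varS_formula d rho0) /N NE.
  have q0 := expR_gt0 (- (2 * rho)); have /andP[_ q1] := q_itv rho0.
  have N1 : 0 < d%:R + 2 - 1 :> R by lra.
  have z0 : 0 < 1 - expR (- (2 * rho)) by rewrite subr_gt0.
  have T0 := moment_sum_gt0 d rho0.
  rewrite DE oppr_eq0; apply: lt0r_neq0.
  apply: divr_gt0; last exact: exprn_gt0.
  apply: mulr_gt0 => //; apply: mulr_gt0; last exact: exprn_gt0.
  by apply: mulr_gt0; [exact: mulr_gt0|exact: exprn_gt0].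
- by move=> rho rho0; rewrite /= NE; exact: varM_formula.
rewrite /= NE.
have -> : 2^-1 * Num.sqrt ((d%:R + 2 + 1) * (d%:R + 2 + 2) * ((d%:R + 2) ^+ 2 - 3 * (d%:R + 2) + 3)
   / ((d%:R + 2) * (d%:R + 2 - 1))) =
   Num.sqrt ((d%:R ^+ 2 + d%:R + 1) / ((d%:R + 1) * (d%:R + 2))) *
    Num.sqrt ((d%:R + 3) * (d%:R + 4) / 4) :> R.
  rewrite -sqrtrM; last first.
    by rewrite divr_ge0 ?mulr_ge0 ?addr_ge0 ?exprn_ge0.
  have {1}-> : 2^-1 = Num.sqrt (2^-1 ^+ 2) :> R by rewrite sqrtr_sqr ger0_norm.
  rewrite -sqrtrM ?sqr_ge0 //; congr Num.sqrt; field.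
  by rewrite !gt_eqF //; lra.
exact: uncertainty_limit.
Qed.
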